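(* Let $\Gamma=(G,\sigma)$ be a connected signed graph on $n\geq 2$ vertices $1,\ldots,n$ and $m$ edges $e_1,\ldots,e_m$ with Laplacian matrix $L$. \begin{enumerate} \item[(a)] If $\Gamma$ is balanced, then \[(L^\dagger)_{ij}=\frac{1}{n^2\tau(\Gamma)^2}\sum_{k=1}^m\ \sum_{T_r,T_s\in\mathcal S(\Gamma),\ e_k\in T_r,\,e_k\in T_s}\mathrm{sgn}(P_{T_r}(e_k-i))\,\mathrm{sgn}(P_{T_s}(e_k-j))\,\Psi(e_k,i,j),\] where (sum over ordered pairs of spanning trees) \[\Psi(e_k,i,j)=\begin{cases}|T^{T_r}_h(e_k)|\,|T^{T_s}_h(e_k)| & \text{if } i\in T^{T_r}_t(e_k),\ j\in T^{T_s}_t(e_k),\\ |T^{T_r}_t(e_k)|\,|T^{T_s}_t(e_k)| & \text{if } i\in T^{T_r}_h(e_k),\ j\in T^{T_s}_h(e_k),\\ -\sigma(e_k)\,|T^{T_r}_h(e_k)|\,|T^{T_s}_t(e_k)| & \text{if } i\in T^{T_r}_t(e_k),\ j\in T^{T_s}_h(e_k),\\ -\sigma(e_k)\,|T^{T_r}_t(e_k)|\,|T^{T_s}_h(e_k)| & \text{if } i\in T^{T_r}_h(e_k),\ j\in T^{T_s}_t(e_k).\end{cases}\] \item[(b)] If $\Gamma$ is unbalanced, then $L$ is invertible and \[(L^{-1})_{ij}=\frac{1}{\big(\sum_{H\in\mathcal{TU}_n(\Gamma)}4^{c(H)}\big)^2}\sum_{k=1}^m\Big(\sum_{H\in\mathcal{TU}_n(\Gamma),\,e_k\in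 H}4^{c(H)}(N_H^\dagger)_{ki}\Big)\Big(\sum_{H\in\mathcal{TU}_n(\Gamma),\,e_k\in H}4^{c(H)}(N_H^\dagger)_{kj}\Big),\] where for $e_k$ in the component $U=U^H_r$ of $H$ with cycle $C=C^H_r$ and a vertex $v$: $(N_H^\dagger)_{kv}=0$ if $v\notin V(U)$, and for $v\in V(U)$, \[(N_H^\dagger)_{kv}=w(e_k)\begin{cases}\tfrac12\mathrm{sgn}(P_{e_k^t-v}) & \text{if } e_k\in C,\\ 0 & \text{if } e_k\notin C,\ v\in U\setminus e_k[C],\\ -\mathrm{sgn}(P_{e_k-v}) & \text{if } e_k \text{ positive}, e_k\notin E(C),\ v\notin U\setminus e_k[C],\ v\in U_h(e_k),\\ \mathrm{sgn}(P_{e_k-v}) & \text{otherwise.}\end{cases}\] \end{enumerate}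
   Context: Signed graph $\Gamma=(G,\sigma)$: simple graph $G=(V,E)$, $V=\{1,\ldots,n\}$, with $\sigma:E\to\{-1,1\}$; $e$ positive if $\sigma(e)=1$, negative if $\sigma(e)=-1$. Its Laplacian is $L=D(G)-A(\Gamma)$, where $D(G)$ is the diagonal degree matrix and $A(\Gamma)_{ij}=\sigma(\{i,j\})$ if $\{i,j\}\in E$ and $0$ otherwise. $\mathrm{sgn}(P)$ is the product of $\sigma$ over a path's edges (1 if empty). A cycle is balanced if it has an even number of negative edges; $\Gamma$ is balanced if all cycles are balanced, otherwise unbalanced. An incidence matrix $N=[n_{k\ell}]$ is an $n\times m$ matrix (rows = vertices, columns = edges) with, for $e_\ell=\{i,j\}$, exactly two nonzero entries $n_{i\ell},n_{j\ell}\in\{\pm1\}$ in column $\ell$, $n_{i\ell}=n_{j\ell}$ if $e_\ell$ negative, $n_{i\ell}=-n_{j\ell}$ if positive; fix one such $N$ (then $L=NN^\intercal$). Head/tail: a positive edge $\{l,m\}$ with $n_{l\ell}=1,n_{m\ell}=-1$ has tail $l$, head $m$; a negative edge $\{l,m\}$ with $l<m$ has tail $l$, head $m$. $w(e_\ell)=-1$ if $e_\ell$ is negative with both nonzero entries of column $\ell$ equal to $-1$, else $1$. $\mathcal S(\Gamma)$ is the set of spanning trees, $\tau(\Gamma)=|\mathcal S(\Gamma)|$. For a spanning tree $T\ni e_k$, $T^T_h(e_k)$, $T^T_t(e_k)$ are the components of $T\setminus e_k$ containing the head and tail of $e_k$ ($|\cdot|$ = number of vertices), and $P_T(e_k-i)$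 is the shortest path in $T$ between vertex $i$ and edge $e_k$ not containing $e_k$. $\mathcal{TU}_n(\Gamma)$ is the set of spanning subgraphs $H$ with exactly $n$ edges each of whose components is a tree or an unbalanced unicyclic graph; $c(H)$ is the number of unbalanced unicyclic components $U^H_r$ (with cycles $C^H_r$). For unicyclic $U$ with cycle $C$ and $e_k\notin C$: $U\setminus e_k[C]$ is the component of $U\setminus e_k$ containing $C$, $U_h(e_k)$ the component of $U\setminus e_k$ containing the head of $e_k$, and $P_{e_k-v}$ the shortest path in $U$ between $v$ and $e_k$ not containing $e_k$; for $e_k\in C$, $e_k^t$ is its tail and $P_{e_k^t-v}$ the path between $e_k^t$ and $v$ in the tree $U\setminus e_k$. *)

(* Defs.v *)
From HB Require Import structures.
From mathcomp Require Import all_boot all_order all_algebra.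

Set Implicit Arguments.
Unset Strict Implicit.
Unset Printing Implicit Defensive.

Import Order.TTheory GRing.Theory Num.Theory.
Local Open Scope ring_scope.

Section MoorePenrose.
Variable R : realFieldType.

Definition is_mpinv m n (A : 'M[R]_(m, n)) (X : 'M[R]_(n, m)) : Prop :=
  [/\ A *m X *m A = A, X *m A *m X = X,
      (A *m X)^T = A *m X & (X *m A)^T = X *m A].

(* Built from the full-rank factorization A = col_base A *m row_base A;
   mpinvP and mpinv_uniq characterize it by the four Penrose equations. *)
Definition mpinv m n (A : 'M[R]_(m, n)) : 'M[R]_(n, m) :=
  let B := col_base A in
  let C := row_base A in
  C^T *m invmx (C *m C^T) *m (invmx (B^T *m B) *m B^T).

Lemma rowV_sqr0 n (x : 'rV[R]_n) : x *m x^T = 0 -> x = 0.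
Proof.
move=> /matrixP /(_ 0 0); rewrite !mxE => h.
have h0 : \sum_j x 0 j ^+ 2 = 0.
  by rewrite -[RHS]h; apply: eq_bigr => j _; rewrite mxE expr2.
apply/rowP=> j; rewrite mxE.
have /psumr_eq0P : forall j : 'I_n, true -> 0 <= x 0 j ^+ 2.
  by move=> *; apply: sqr_ge0.
by move=> /(_ h0 j isT) /eqP; rewrite sqrf_eq0 => /eqP.
Qed.

Lemma gram_unit m n (C : 'M[R]_(m, n)) : row_free C -> C *m C^T \in unitmx.
Proof.
move=> fC; rewrite -row_free_unit; apply: inj_row_free => v hv.
have: (v *m C) *m (v *m C)^T = 0.
  by rewrite trmx_mul !mulmxA -(mulmxA v) hv mul0mx.
by move/rowV_sqr0 => h; apply: (row_free_inj fC); rewrite h mul0mx.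
Qed.

Lemma full_rank_mpinv m n r (B : 'M[R]_(m, r)) (C : 'M[R]_(r, n)) :
  B^T *m B \in unitmx -> C *m C^T \in unitmx ->
  is_mpinv (B *m C) (C^T *m invmx (C *m C^T) *m (invmx (B^T *m B) *m B^T)).
Proof.
move=> uB uC; set X := _ *m (_ *m _).
have eAX : B *m C *m X = B *m invmx (B^T *m B) *m B^T.
  rewrite /X -!mulmxA (mulmxA C) (mulmxA (C *m C^T)) mulmxV // mul1mx.
  by [].
have eXA : X *m (B *m C) = C^T *m invmx (C *m C^T) *m C.
  rewrite /X -!mulmxA (mulmxA B^T) (mulmxA (invmx (B^T *m B))) mulVmx //.
  by rewrite mul1mx.
split.
- by rewrite eAX -!mulmxA (mulmxA B^T) (mulmxA (invmx _)) mulVmx // mul1mx.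
- rewrite eXA /X -!mulmxA (mulmxA C) (mulmxA (C *m C^T)) mulmxV // mul1mx.
  by [].
- by rewrite eAX !trmx_mul trmxK trmx_inv trmx_mul trmxK mulmxA.
- by rewrite eXA !trmx_mul trmxK trmx_inv trmx_mul trmxK mulmxA.
Qed.

Lemma mpinvP m n (A : 'M[R]_(m, n)) : is_mpinv A (mpinv A).
Proof.
have uC : row_base A *m (row_base A)^T \in unitmx.
  exact/gram_unit/row_base_free.
have uB : (col_base A)^T *m col_base A \in unitmx.
  rewrite -{2}[col_base A]trmxK; apply: gram_unit.
  by rewrite /row_free mxrank_tr; apply: col_base_full.
by have := full_rank_mpinv uB uC; rewrite {1}mulmx_base.
Qed.

Lemma mpinv_uniq m n (A : 'M[R]_(m, n)) X Y :
  is_mpinv A X -> is_mpinv A Y -> X = Y.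
Proof.
move=> [a1 a2 a3 a4] [b1 b2 b3 b4].
have e1 : A *m X = A *m Y.
  rewrite -{1}b1 -(mulmxA (A *m Y)) -a3 -b3 -trmx_mul mulmxA a1.
  by rewrite b3.
have e2 : X *m A = Y *m A.
  rewrite -{1}b1 -(mulmxA A) mulmxA -a4 -b4 -trmx_mul -mulmxA (mulmxA A) a1.
  by rewrite b4.
by rewrite -a2 e2 -mulmxA e1 mulmxA.
Qed.

End MoorePenrose.

(* The edges e_1, ..., e_m are given by an injective enumeration of a set of
   two-element sets of vertices; sigma is indexed accordingly.  A spanning
   subgraph is a set of edge indices, {set 'I_m}. *)
Record signed_graph (n m : nat) := SignedGraph {
  edge : 'I_m -> {set 'I_n};
  edge_card : forall k, #|edge k| = 2%N;
  edge_inj : injective edge;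
  sigma : 'I_m -> int;
  sigma_pm1 : forall k, sigma k = 1 \/ sigma k = -1
}.

Section Graph.
Variables (n m : nat) (G : signed_graph n m).
Implicit Types (S T H C : {set 'I_m}) (W Q : {set 'I_n}) (k : 'I_m).

Definition positive k := sigma G k == 1.
Definition negative k := sigma G k == -1.

Definition degree (i : 'I_n) : nat := #|[set k | i \in edge G k]|.

Definition adjacency (R : realFieldType) : 'M[R]_n :=
  \matrix_(i, j) if [pick k | edge G k == [set i; j]] is Some k
                 then (sigma G k)%:~R else 0.

Definition laplacian (R : realFieldType) : 'M[R]_n :=
  diag_mx (\row_i (degree i)%:R) - adjacency R.

Definition adj S : rel 'I_n :=
  fun u v => [exists k in S, edge G k == [set u; v]].

Definition component S (u : 'I_n) : {set 'I_n} := [set v | connect (adj S) u v].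

Definition comps S : {set {set 'I_n}} := [set component S u | u : 'I_n].

Definition restr S W : {set 'I_m} := [set k in S | edge G k \subset W].

Definition connected_on W S : bool :=
  [forall u in W, forall v in W, connect (adj S) u v].

Definition connected_graph : bool := connected_on [set: 'I_n] [set: 'I_m].

(* A cycle is represented by its set of edges; c lists its vertices, which are
   distinct, so size c <= n and n.-bseq loses nothing. *)
Definition is_vertex_cycle S (c : seq 'I_n) : bool :=
  [&& 2 < size c, cycle (adj S) c & uniq c]%N.

Definition cycle_edges (c : seq 'I_n) : {set 'I_m} :=
  [set k | [exists x, (x \in c) && (edge G k == [set x; next c x])]].

Definition cycles S : {set {set 'I_m}} :=
  [set C : {set 'I_m} | [exists c : n.-bseq 'I_n,
              is_vertex_cycle S c && (C == cycle_edges c)]].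

Definition balanced_cycle C : bool := ~~ odd #|[set k in C | negative k]|.

Definition balanced S : bool := [forall C in cycles S, balanced_cycle C].

Definition balanced_graph : bool := balanced [set: 'I_m].

(* Subgraph with vertex set W and edge set S. *)
Definition is_tree W S : bool := connected_on W S && (cycles S == set0).

Definition is_unicyclic W S : bool := connected_on W S && (#|cycles S| == 1%N).

Definition spanning_trees : {set {set 'I_m}} :=
  [set T : {set 'I_m} | is_tree [set: 'I_n] T].

Definition tau : nat := #|spanning_trees|.

Definition unbalanced_unicyclic_comp H W : bool :=
  is_unicyclic W (restr H W) && ~~ balanced (restr H W).

Definition TUn : {set {set 'I_m}} :=
  [set H : {set 'I_m} | (#|H| == n) &&
     [forall W in comps H,
        is_tree W (restr H W) || unbalanced_unicyclic_comp H W]].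

Definition cU H : nat :=
  #|[set W in comps H | unbalanced_unicyclic_comp H W]|.

Definition path_edges (u : 'I_n) (p : seq 'I_n) : {set 'I_m} :=
  [set k | has (fun xy => edge G k == [set xy.1; xy.2]) (zip (u :: p) p)].

Definition path_to S (u : 'I_n) Q (p : seq 'I_n) : bool :=
  path (adj S) u p && (last u p \in Q).

Definition shortest_path_to S (u : 'I_n) Q (p : n.-bseq 'I_n) : bool :=
  path_to S u Q p &&
  [forall q : n.-bseq 'I_n, path_to S u Q q ==> (size p <= size q)%N].

(* The sign of the shortest path in S from u to the set Q of vertices.  It is
   only used where this path exists and is unique. *)
Definition sgn_path S (u : 'I_n) Q : int :=
  if [pick p : n.-bseq 'I_n | shortest_path_to S u Q p] is Some p
  then \prod_(k in path_edges u p) sigma G k else 0.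

(* sgn(P_T(e_k - i)): a path in T avoiding e_k is a path in T :\ k. *)
Definition sgn_edge_path T k (i : 'I_n) : int := sgn_path (T :\ k) i (edge G k).

Section Incidence.
Variable R : realFieldType.

Definition is_incidence (N : 'M[R]_(n, m)) : Prop :=
  forall k, [/\ forall v, v \notin edge G k -> N v k = 0,
                forall v, v \in edge G k -> N v k = 1 \/ N v k = -1
              & forall i j, i != j -> edge G k = [set i; j] ->
                  if negative k then N i k = N j k else N i k = - N j k].

Variable N : 'M[R]_(n, m).

Definition is_tail k (v : 'I_n) : bool :=
  (v \in edge G k) &&
  (if positive k then N v k == 1
   else [forall u in edge G k, (v <= u)%N]).

Definition is_head k (v : 'I_n) : bool :=
  (v \in edge G k) &&
  (if positive k then N v k == -1
   else [forall u in edge G k, (u <= v)%N]).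

Definition edge_w k : R :=
  if negative k && [forall v in edge G k, N v k == -1] then -1 else 1.

(* Vertex sets of the components of S \ e_k containing the head, resp. the
   tail, of e_k; each union has a single term. *)
Definition head_comp S k : {set 'I_n} :=
  \bigcup_(v | is_head k v) component (S :\ k) v.

Definition tail_comp S k : {set 'I_n} :=
  \bigcup_(v | is_tail k v) component (S :\ k) v.

Definition Psi (Tr Ts : {set 'I_m}) k (i j : 'I_n) : R :=
  let hr := #|head_comp Tr k|%:R in
  let tr := #|tail_comp Tr k|%:R in
  let hs := #|head_comp Ts k|%:R in
  let ts := #|tail_comp Ts k|%:R in
  let s := (sigma G k)%:~R in
  if (i \in tail_comp Tr k) && (j \in tail_comp Ts k) then hr * hs
  else if (i \in head_comp Tr k) && (j \in head_comp Ts k) then tr * ts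
  else if (i \in tail_comp Tr k) && (j \in head_comp Ts k) then - s * hr * ts
  else if (i \in head_comp Tr k) && (j \in tail_comp Ts k) then - s * tr * hs
  else 0.

Definition sub_incidence H : 'M[R]_(n, #|H|) :=
  colsub (fun l : 'I_#|H| => enum_val l) N.

(* Entry of the Moore-Penrose inverse of N_H in the row labelled by e_k. *)
Definition NH_pinv H k (v : 'I_n) : R :=
  if [pick l : 'I_#|H| | enum_val l == k] is Some l
  then mpinv (sub_incidence H) l v else 0.

(* Both ends of e_k \in H lie in the same component of H. *)
Definition comp_of_edge H k : {set 'I_n} :=
  \bigcup_(u in edge G k) component H u.

Definition the_cycle S : {set 'I_m} := odflt set0 [pick C in cycles S].

(* Vertices of the component of S \ e_k containing the cycle C. *)
Definition cycle_comp S k C : {set 'I_n} :=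
  \bigcup_(l in C) \bigcup_(u in edge G l) component (S :\ k) u.

Definition NH_formula H k (v : 'I_n) : R :=
  let W := comp_of_edge H k in
  let U := restr H W in
  let C := the_cycle U in
  if v \notin W then 0 else
  edge_w k *
  (if k \in C then
     2^-1 * (sgn_path (U :\ k) v [set t | is_tail k t])%:~R
   else if v \in cycle_comp U k C then 0
   else if positive k && (v \in head_comp U k) then - (sgn_edge_path U k v)%:~R
   else (sgn_edge_path U k v)%:~R).

End Incidence.
End Graph.

(* Main.v *)
(* With s a sign vector in the left kernel of N when the graph is balanced, put
   A = [N | s] in the balanced case and A = N in the unbalanced one, so that A
   has full row rank.  By Cauchy-Binet and Cramer's rule, (A A^T)^-1 A is the
   average of the inverses of the nonsingular maximal column submatrices of A,
   weighted by their squared determinants; these submatrices correspond to the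
   spanning trees, resp. to the elements of TU_n.  A row vector x satisfies
   x N_k = 0 iff x_u = sigma_k x_v on the ends u, v of e_k, so the rows of the
   inverses are read off from signs of paths.  The determinants are computed
   by choosing a root in every component and pairing every other vertex with
   the first edge of a shortest path to the root, which makes the matrix
   triangular: the squares are n^2 and 4^c(H).  Bounds on numbers of edges come
   from ranks. *)
Require Import Defs.
From mathcomp Require Import all_boot all_order all_algebra all_fingroup ring.
Import Order.TTheory GRing.Theory Num.Theory.
Set Implicit Arguments.
Unset Strict Implicit.
Unset Printing Implicit Defensive.
Local Open Scope ring_scope.

(** * Cauchy-Binet expansions *)

(** Both inverses are Gram products, which is why each term in k splits into a factor in i and a
    factor in j. If L = N N^T is invertible, then L^-1 = X X^T with X = L^-1 N. If L is singular
    with kernel spanned by s, then L + s s^T is invertible, acts as L on the vectors orthogonal to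
    s, and the Moore-Penrose inverse is X X^T with X = (L + s s^T)^-1 N; the adjoined column helps
    to invert but contributes no term.

    The main obstacle is the signs of paths. No path is traced when an inverse is verified: on a
    balanced piece there is a sign function compatible with all edges, the sign of a path is the
    product of its values at the two ends, and the duality with a column becomes a local check at
    the ends of one edge.

    The constants come from the same functions. The value n is the pairing of s with itself. The
    value 4 is (1 + 1)^2: a sign function on a component cut open at an edge of its unbalanced cycle
    violates exactly the condition of that edge, so both ends contribute equally to the pairing with
    its column. *)

Section CauchyBinet.
Variables (R : realFieldType) (n : nat) (I : finType).
Implicit Types (A : 'I_n -> I -> R) (H : {set I}).

(** The sum over all functions counts every n-subset of columns once per ordering; the factor [n!]
    avoids choosing an ordering and is cancelled only at the end. Multilinearity in the rows leaves
    a single product of entries of [A] in each term; reindexing by every permutation and adding up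
    completes it to a determinant. *)
Lemma cauchy_binet A (B : I -> 'I_n -> R) :
  n`!%:R * \det (\matrix_(i, j) \sum_k A i k * B k j) =
  \sum_(f : {ffun 'I_n -> I})
     \det (\matrix_(i, j) A i (f j)) * \det (\matrix_(i, j) B (f i) j).
Proof.
pose Bf (f : {ffun 'I_n -> I}) := \det (\matrix_(i, j) B (f i) j) : R.
have detE : \det (\matrix_(i, j) \sum_k A i k * B k j) =
    \sum_(f : {ffun 'I_n -> I}) (\prod_i A i (f i)) * Bf f.
  rewrite /determinant.
  under eq_bigr => s _.
    under eq_bigr => i _ do rewrite mxE.
    rewrite bigA_distr_bigA big_distrr /=.
    over.
  rewrite exchange_big; apply: eq_bigr => f _ /=.
  rewrite /Bf /determinant big_distrr; apply: eq_bigr => s _ /=.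
  rewrite big_split /= mulrCA; congr (_ * (_ * _)).
  by apply: eq_bigr => i _; rewrite mxE.
have perE (s : 'S_n) : \det (\matrix_(i, j) \sum_k A i k * B k j) =
    \sum_(f : {ffun 'I_n -> I}) ((-1) ^+ s * \prod_i A i (f (s i))) * Bf f.
  rewrite detE.
  pose h (f : {ffun 'I_n -> I}) : {ffun 'I_n -> I} := [ffun i => f (s i)].
  have hbij : bijective h.
    exists (fun f : {ffun 'I_n -> I} => [ffun i => f ((s^-1)%g i)]) => f;
      by apply/ffunP=> i; rewrite !ffunE ?permK ?permKV.
  rewrite (reindex h) /=; last exact: onW_bij.
  apply: eq_bigr => f _.
  have -> : Bf (h f) = (-1) ^+ s * Bf f.
    rewrite /Bf -det_perm -det_mulmx -row_permE; congr (\det _).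
    by apply/matrixP=> i j; rewrite !mxE ffunE.
  rewrite mulrA [_ * (-1) ^+ s]mulrC; congr (_ * _ * _).
  by apply: eq_bigr => i _; rewrite ffunE.
have -> : n`!%:R * \det (\matrix_(i, j) \sum_k A i k * B k j) =
    \sum_(s : 'S_n) \det (\matrix_(i, j) \sum_k A i k * B k j).
  by rewrite sumr_const card_Sn mulr_natl.
under eq_bigr => s _ do rewrite (perE s).
rewrite exchange_big; apply: eq_bigr => f _ /=.
rewrite -mulr_suml /determinant; congr (_ * _); apply: eq_bigr => s _.
by congr (_ * _); apply: eq_bigr => i _; rewrite mxE.
Qed.

Definition gram A H : 'M[R]_n := \matrix_(u, v) \sum_(l in H) A u l * A v l.

Definition cols A (f : 'I_n -> I) : 'M[R]_n := \matrix_(i, j) A i (f j).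

Lemma det_gram A (f : 'I_n -> I) H :
  injective f -> H = [set f i | i : 'I_n] -> \det (gram A H) = \det (cols A f) ^+ 2.
Proof.
move=> finj ->; rewrite expr2 -[X in _ = _ * X]det_tr -det_mulmx; congr (\det _).
apply/matrixP=> u v; rewrite !mxE big_imset /=; last by move=> ? ? _ _ /finj.
by apply: eq_bigr => i _; rewrite !mxE.
Qed.

Lemma adj_gram_cols A k v :
  n`!%:R * \sum_u (\adj (gram A [set: I])) v u * A u k =
  \sum_(f : {ffun 'I_n -> I})
     \det (cols A f) * \sum_(i | f i == k) (\adj (cols A f)) i v.
Proof.
(* Cramer's rule: with the indicator of [k] as column [v] of the right factor, the product is the
   Gram matrix with column [v] replaced by column [k] of [A]; expanding along it gives the adjugate
   sum. *)
have := cauchy_binet A (fun l j => if j == v then (l == k)%:R else A j l).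
rewrite (expand_det_col _ v) => e.
transitivity (\sum_(f : {ffun 'I_n -> I}) \det (cols A f) *
   \det (\matrix_(i, j) (if j == v then (f i == k)%:R else A j (f i)))).
  rewrite -[RHS]e; congr (_ * _); apply: eq_bigr => u _.
  rewrite !mxE mulrC eqxx; congr (_ * _).
    rewrite (bigD1 k) //= eqxx mulr1 big1 ?addr0 // => l /negPf ->.
    by rewrite mulr0.
  rewrite /cofactor; congr (_ * \det _); apply/matrixP=> i j; rewrite !mxE.
  rewrite eq_sym (negPf (neq_lift _ _)).
  by apply: eq_bigl => l; rewrite in_setT.
apply: eq_bigr => f _; congr (_ * _).
rewrite (expand_det_col _ v) [RHS]big_mkcond; apply: eq_bigr => i _.
rewrite !mxE eqxx; case: (f i == k); rewrite ?mul0r // mul1r -cofactor_tr.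
rewrite /cofactor; congr (_ * \det _); apply/matrixP=> a b; rewrite !mxE.
by rewrite eq_sym (negPf (neq_lift _ _)).
Qed.

Definition annih A H (x : 'I_n -> R) := forall l, l \in H -> \sum_v x v * A v l = 0.

(** Full row rank of the columns in [H], phrased through the left kernel so that it can be tested on
    functions on the vertices. *)
Definition rigid A H := forall x, annih A H x -> forall v, x v = 0.

Definition dual_rows A H (X : I -> 'I_n -> R) :=
  forall k l, k \in H -> l \in H -> \sum_v X k v * A v l = (k == l)%:R.

Definition subcols A H : 'M[R]_(n, #|H|) := \matrix_(v, j) A v (enum_val j).

Lemma gramE A H : gram A H = subcols A H *m (subcols A H)^T.
Proof.
apply/matrixP=> u v; rewrite !mxE big_enum_val.
by apply: eq_bigr => j _; rewrite !mxE.
Qed.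

Lemma rigid_row_free A H : rigid A H -> row_free (subcols A H).
Proof.
move=> rH; apply: inj_row_free => x /rowP x0; apply/rowP=> v; rewrite mxE.
apply: (rH (fun v => x 0 v)) => l lH.
have := x0 (enum_rank_in lH l); rewrite !mxE => e; rewrite -[RHS]e.
by apply: eq_bigr => u _; rewrite mxE enum_rankK_in.
Qed.

Lemma rigid_card A H : rigid A H -> (n <= #|H|)%N.
Proof. by move=> /rigid_row_free/eqP <-; apply: rank_leq_col. Qed.

Lemma rigid_gram_unit A H : rigid A H -> gram A H \in unitmx.
Proof. by move=> /rigid_row_free; rewrite gramE; apply: gram_unit. Qed.

Definition rows H (X : I -> 'I_n -> R) : 'M[R]_(#|H|, n) :=
  \matrix_(j, v) X (enum_val j) v.

Lemma dual_rowsE A H X : dual_rows A H X -> rows H X *m subcols A H = 1%:M.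
Proof.
move=> dX; apply/matrixP=> i j; rewrite !mxE.
rewrite -(inj_eq enum_val_inj) -dX ?enum_valP //.
by apply: eq_bigr => v _; rewrite !mxE.
Qed.

Lemma dual_rows_card A H X : dual_rows A H X -> (#|H| <= n)%N.
Proof. by move/dual_rowsE/mulmx1_min. Qed.

(** For matrices that are square only up to a propositional equality such as [#|H| = n]. *)
Lemma mulmx1_comm p q (A : 'M[R]_(p, q)) (X : 'M[R]_(q, p)) :
  p = q -> X *m A = 1%:M -> A *m X = 1%:M.
Proof. by move=> e; case: q / e A X => A X; apply: mulmx1C. Qed.

Lemma dual_rows_rigid A H X : dual_rows A H X -> #|H| = n -> rigid A H.
Proof.
move=> /dual_rowsE dX cH x ax v.
have e : subcols A H *m rows H X = 1%:M by apply: mulmx1_comm.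
have : (\row_v x v) *m (subcols A H *m rows H X) = 0.
  rewrite mulmxA (_ : _ *m subcols A H = 0) ?mul0mx //.
  apply/rowP=> j; rewrite !mxE -[RHS](ax _ (enum_valP j)).
  by apply: eq_bigr => u _; rewrite !mxE.
by rewrite e mulmx1 => /rowP/(_ v); rewrite !mxE.
Qed.

(** * Averages over the nonsingular maximal column submatrices *)

Section Expansion.
Variables (A : 'I_n -> I -> R) (HH : {set {set I}}) (w : {set I} -> R).
Variable X : {set I} -> I -> 'I_n -> R.
Hypothesis card_HH : forall H, H \in HH -> #|H| = n.
Hypothesis det_HH : forall H, H \in HH -> \det (gram A H) = w H.
Hypothesis rigid_HH : forall H, #|H| = n -> rigid A H -> H \in HH.
Hypothesis dual_HH : forall H, H \in HH -> dual_rows A H (X H).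

Lemma det_cols_neq0 (f : {ffun 'I_n -> I}) :
  \det (cols A f) != 0 -> injective f /\ [set f i | i : 'I_n] \in HH.
Proof.
move=> d0; have finj : injective f.
  move=> i j fij; apply/eqP/negPn/negP=> ij; case/eqP: d0.
  rewrite -det_tr; apply: (determinant_alternate ij) => l.
  by rewrite !mxE fij.
split=> //; apply: rigid_HH; first by rewrite card_imset // card_ord.
move=> x ax v; have U : cols A f \in unitmx by rewrite unitmxE unitfE.
have /(canRL (mulmxK U)) : (\row_v x v) *m cols A f = 0.
  apply/rowP=> i; rewrite !mxE -[RHS](ax (f i)) ?imset_f //.
  by apply: eq_bigr => u _; rewrite !mxE.
by rewrite mul0mx => /rowP/(_ v); rewrite !mxE.
Qed.

Lemma adj_cols (f : {ffun 'I_n -> I}) H i v : H = [set f i | i : 'I_n] -> 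
  injective f -> H \in HH -> (\adj (cols A f)) i v = \det (cols A f) * X H (f i) v.
Proof.
move=> eH finj HHH; pose Y : 'M[R]_n := \matrix_(i, v) X H (f i) v.
have YA : Y *m cols A f = 1%:M.
  apply/matrixP=> a b; rewrite !mxE -(inj_eq finj) -(dual_HH HHH); last 2 first.
  - by rewrite eH imset_f.
  - by rewrite eH imset_f.
  by apply: eq_bigr => u _; rewrite !mxE.
have: Y *m (cols A f *m \adj (cols A f)) = \adj (cols A f).
  by rewrite mulmxA YA mul1mx.
by rewrite mul_mx_adj mul_mx_scalar => /matrixP/(_ i v) <-; rewrite !mxE.
Qed.

(** A set of n elements is the image of exactly [n!] injections, which matches the factor in
    [cauchy_binet]. *)
Lemma sum_images (g : {set I} -> R) :
  \sum_(f : {ffun 'I_n -> I} | injectiveb f && ([set f i | i : 'I_n] \in HH))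
     g [set f i | i : 'I_n] = n`!%:R * \sum_(H in HH) g H.
Proof.
rewrite (partition_big (fun f : {ffun 'I_n -> I} => [set f i | i : 'I_n])
  (mem HH)) /=; last by move=> f /andP[].
rewrite big_distrr; apply: eq_bigr => H HHH /=.
rewrite (eq_bigr (fun=> g H)); last by move=> f /andP[_ /eqP ->].
rewrite sumr_const mulr_natl; congr (_ *+ _).
have -> : n`! = (#|H| ^_ #|'I_n|)%N by rewrite (card_HH HHH) card_ord ffactnn.
rewrite -card_inj_ffuns_on.
apply: eq_card => f; rewrite !inE; apply/idP/idP.
  case/andP=> /andP[fi _] /eqP fH; rewrite fi andbT.
  by apply/ffun_onP=> i; rewrite -fH imset_f.
case/andP=> /ffun_onP fH fi; rewrite unfold_in /= fi /=.
suff -> : [set f i | i : 'I_n] = H by rewrite HHH eqxx.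
apply/eqP; rewrite eqEcard card_imset; last exact/injectiveP.
rewrite card_ord (card_HH HHH) leqnn andbT.
by apply/subsetP=> _ /imsetP[i _ ->].
Qed.

Lemma fact_neq0 : n`!%:R != 0 :> R.
Proof. by rewrite pnatr_eq0 -lt0n fact_gt0. Qed.

Lemma restrict_cols (F : {ffun 'I_n -> I} -> R) :
  \sum_(f : {ffun _ -> I}) \det (cols A f) * F f =
  \sum_(f : {ffun 'I_n -> I} | injectiveb f && ([set f i | i : 'I_n] \in HH))
    \det (cols A f) * F f.
Proof.
rewrite [RHS]big_mkcond; apply: eq_bigr => f _.
case: (eqVneq (\det (cols A f)) 0) => [->|/det_cols_neq0[/injectiveP -> ->]//].
by rewrite mul0r if_same.
Qed.

Lemma det_gram_expansion : \det (gram A [set: I]) = \sum_(H in HH) w H.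
Proof.
apply: (mulfI fact_neq0); rewrite -sum_images.
have := cauchy_binet A (fun l j => A j l); rewrite restrict_cols => e.
transitivity (n`!%:R * \det (\matrix_(i, j) \sum_k A i k * A j k)).
  congr (_ * \det _); apply/matrixP=> u v; rewrite !mxE.
  by apply: eq_bigl => l; rewrite in_setT.
rewrite e; apply: eq_bigr => f /andP[/injectiveP finj fH].
rewrite -det_HH // (det_gram A finj erefl) expr2; congr (_ * _).
by rewrite -det_tr; congr (\det _); apply/matrixP=> i j; rewrite !mxE.
Qed.

Lemma adj_gram_expansion k v :
  \sum_u (\adj (gram A [set: I])) v u * A u k =
  \sum_(H in HH | k \in H) w H * X H k v.
Proof.
apply: (mulfI fact_neq0); rewrite adj_gram_cols restrict_cols.
rewrite [in RHS]big_mkcondr -sum_images; apply: eq_bigr => f.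
case/andP=> /injectiveP finj fH; set H := [set _ | _ in _].
rewrite -det_HH // (det_gram A finj erefl).
case: ifP => [/imsetP[i _ ->]|kH].
  rewrite (big_pred1 i) => [|j]; last by rewrite /= (inj_eq finj).
  by rewrite (adj_cols _ _ (erefl H)) // expr2 mulrA.
by rewrite big_pred0 ?mulr0 // => i; apply: contraFF kH => /eqP <-; rewrite imset_f.
Qed.

End Expansion.
End CauchyBinet.

(** A permutation with a nonzero product never decreases [d], and increases it strictly at a moved
    point; the sum of [d] would then exceed itself. A rank function replaces an ordering of the
    vertices, and ties are allowed. *)
Lemma det_triangular (R : realFieldType) n (M : 'M[R]_n) (d : 'I_n -> nat) :
  (forall i j, i != j -> M i j != 0 -> (d i < d j)%N) ->
  \det M = \prod_i M i i.
Proof.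
move=> tri; rewrite /determinant (bigD1 1%g) //= odd_perm1 mul1r.
rewrite [X in _ + X]big1 ?addr0 => [|s s1].
  by apply: eq_bigr => i _; rewrite perm1.
apply/eqP; rewrite mulf_eq0; apply/orP; right; apply/negPn/negP.
move/prodf_neq0 => nz.
have le i : (d i <= d (s i))%N.
  by case: (eqVneq i (s i)) => [<-//|ne]; apply/ltnW/tri => //; apply: nz.
have [i si] : exists i, i != s i.
  apply/existsP; rewrite -negb_forall; apply: contra s1 => /forallP h.
  by apply/eqP/permP=> i; rewrite perm1 -(eqP (h i)).
have lt : (d i < d (s i))%N by apply: tri => //; apply: nz.
suff : (\sum_j d j < \sum_j d (s j))%N.
  rewrite [X in (_ < X)%N](_ : _ = \sum_j d j)%N ?ltnn //.
  by rewrite [RHS](reindex_inj (@perm_inj _ s)).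
rewrite (bigD1 i) //= [X in (_ < X)%N](bigD1 i) //= -addSn leq_add //.
by apply: leq_sum.
Qed.

(* Substituting the rows Y t for the root rows of Z makes Z triangular. *)
Lemma det_forest (R : realFieldType) n (Z : 'M[R]_n) (Y : 'I_n -> 'I_n -> R)
    (rt : pred 'I_n) (d : 'I_n -> nat) (alpha : R) :
  (forall v, ~~ rt v -> Z v v ^+ 2 = 1) ->
  (forall u v, ~~ rt v -> u != v -> Z u v != 0 -> (d u < d v)%N) ->
  (forall t, rt t -> Y t t ^+ 2 = 1) ->
  (forall t t', rt t -> rt t' -> t != t' -> Y t t' = 0) ->
  (forall t v, rt t -> v != t -> \sum_u Y t u * Z u v = 0) ->
  (forall t, rt t -> (\sum_u Y t u * Z u t) ^+ 2 = alpha) ->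
  \det Z ^+ 2 = alpha ^+ #|rt|.
Proof.
move=> Zd Zt Yd Yt YZ0 YZ.
pose W : 'M[R]_n := \matrix_(u, v) if rt u then Y u v else (u == v)%:R.
pose Q := W *m Z.
have Qrt u v : rt u -> Q u v = \sum_w Y u w * Z w v.
  by move=> ru; rewrite mxE; apply: eq_bigr => w _; rewrite mxE ru.
have Qnrt u v : ~~ rt u -> Q u v = Z u v.
  move=> ru; rewrite mxE (bigD1 u) //= mxE (negPf ru) eqxx mul1r.
  rewrite big1 ?addr0 // => w wu; rewrite mxE (negPf ru) eq_sym (negPf wu).
  by rewrite mul0r.
have detW : \det W ^+ 2 = 1.
  rewrite (@det_triangular _ _ _ (fun u => ~~ rt u : nat)).
    rewrite -prodrXl big1 // => i _; rewrite mxE eqxx.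
    by case: ifP => [/Yd//|_]; rewrite expr1n.
  move=> i j ij; rewrite mxE; case: ifP => [ri|_]; last by rewrite (negPf ij) eqxx.
  by case: (boolP (rt j)) => [rj|//]; rewrite Yt ?eqxx.
have detQ : \det Q ^+ 2 = alpha ^+ #|rt|.
  (* Root columns of [Q] are unrestricted while root rows vanish off the diagonal, so roots are
     ranked above every value of [d]. *)
  rewrite (@det_triangular _ _ _ (fun u => if rt u then (\max_i d i).+1 else d u)).
    rewrite -prodrXl (bigID rt) /= [X in _ * X]big1 => [|i ri]; last first.
      by rewrite Qnrt // Zd.
    rewrite mulr1 (eq_bigr (fun=> alpha)) ?prodr_const // => i ri.
    by rewrite Qrt // YZ.
  move=> i j ij; case: (boolP (rt i)) => [ri|ri].
    by rewrite Qrt // YZ0 ?eqxx // eq_sym.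
  rewrite Qnrt //; case: ifP => [_ _|rj Zij]; first by rewrite ltnS leq_bigmax.
  by apply: Zt; rewrite ?rj.
by rewrite -detQ det_mulmx exprMn detW mul1r.
Qed.

(** * Walks and cycles *)

Section Walks.
Variables (R : realFieldType) (n m : nat) (G : signed_graph n m).
Implicit Types (S T H C : {set 'I_m}) (W Q : {set 'I_n}) (k l : 'I_m).

(** The left annihilators of the columns in [S] of any incidence matrix, described without an
    orientation; arbitrary values, including zero, are allowed. *)
Definition switching S (x : 'I_n -> R) :=
  forall k u v, k \in S -> edge G k = [set u; v] -> x u = (sigma G k)%:~R * x v.

Lemma switchingS S S' x : S \subset S' -> switching S' x -> switching S x.
Proof. by move=> /subsetP sS h k u v /sS; apply: h. Qed.

Lemma edge_ends k : exists u v, u != v /\ edge G k = [set u; v].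
Proof. by apply/cards2P; rewrite edge_card. Qed.

Lemma edge_neq k u v : edge G k = [set u; v] -> u != v.
Proof.
by move=> e; have := edge_card G k; rewrite e cards2; case: (u != v).
Qed.

Lemma edge_eq k l u v : edge G k = [set u; v] -> edge G l = [set u; v] -> k = l.
Proof. by move=> ek el; apply: (@edge_inj _ _ G); rewrite ek el. Qed.

Lemma sigma_sqr k : (sigma G k)%:~R * (sigma G k)%:~R = 1 :> R.
Proof. by case: (sigma_pm1 G k) => ->; rewrite ?mulrNN mulr1. Qed.

Lemma adjP S u v :
  reflect (exists2 k, k \in S & edge G k = [set u; v]) (adj G S u v).
Proof.
apply: (iffP existsP) => [[k /andP[kS /eqP]]|[k kS e]]; exists k => //.
by rewrite kS e eqxx.
Qed.

Lemma adj_sym S : symmetric (adj G S).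
Proof. by move=> u v; rewrite /adj setUC. Qed.

Lemma connect_adjC S : connect_sym (adj G S).
Proof. exact/sym_connect_sym/adj_sym. Qed.

Lemma adjS S S' : S \subset S' -> subrel (adj G S) (adj G S').
Proof. by move=> /subsetP sS u v /adjP[k /sS kS e]; apply/adjP; exists k. Qed.

Lemma connectS S S' : S \subset S' ->
  subrel (connect (adj G S)) (connect (adj G S')).
Proof.
by move=> sS; apply: connect_sub => u v /(adjS sS) /connect1.
Qed.

Lemma edge_connect S k u v :
  k \in S -> edge G k = [set u; v] -> connect (adj G S) u v.
Proof. by move=> kS e; apply/connect1/adjP; exists k. Qed.

Lemma path_edges_cons u v p k : edge G k = [set u; v] ->
  path_edges G u (v :: p) = k |: path_edges G v p.
Proof.
move=> e; apply/setP=> l; rewrite !inE /=; congr (_ || _).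
apply/eqP/eqP => [el|->//]; exact: edge_eq el e.
Qed.

Lemma path_edgesP u p k : reflect
  (exists2 i, (i < size p)%N & edge G k = [set nth u (u :: p) i; nth u p i])
  (k \in path_edges G u p).
Proof.
rewrite inE; have sz : size (zip (u :: p) p) = size p.
  by rewrite size_zip /= (minn_idPr _).
apply: (iffP (has_nthP (u, u))); rewrite sz => -[i ip].
  by rewrite nth_zip_cond sz ip => /eqP e; exists i.
by move=> e; exists i => //; rewrite nth_zip_cond sz ip /= e.
Qed.

Lemma path_edges_mem u p k v :
  k \in path_edges G u p -> v \in edge G k -> v \in u :: p.
Proof.
case/path_edgesP=> i ip -> /set2P[]->; first by rewrite mem_nth // ltnS ltnW.
by rewrite inE mem_nth ?orbT.
Qed.

Lemma path_edges_sub S u p : path (adj G S) u p -> path_edges G u p \subset S.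
Proof.
elim: p u => [|v p IH] u /=; first by move=> _; apply/subsetP=> k; rewrite inE.
case/andP=> /adjP[k kS e] /IH sp; rewrite (path_edges_cons p e).
by rewrite subUset sub1set kS.
Qed.

Lemma path_on_edges S u p :
  path (adj G S) u p -> path (adj G (path_edges G u p)) u p.
Proof.
elim: p u => [//|v p IH] u /= /andP[/adjP[k kS e] /IH pp].
rewrite (path_edges_cons p e); apply/andP; split.
  by apply/adjP; exists k; rewrite // setU11.
by apply: sub_path pp; apply: adjS; apply: subsetUr.
Qed.

(** The product runs over a set of edges; distinct vertices ensure that the first edge does not
    recur, so each sign is picked up exactly once along the path. *)
Lemma switching_path S u p x : path (adj G S) u p -> uniq (u :: p) ->
  switching (path_edges G u p) x ->
  x u = (\prod_(k in path_edges G u p) sigma G k)%:~R * x (last u p).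
Proof.
elim: p u => [|v p IH] u /=.
  move=> _ _ _; rewrite big_pred0 ?mul1r // => k.
  by rewrite inE.
case/andP=> /adjP[k kS e] pp /andP[uvp up]; rewrite (path_edges_cons p e) => sw.
have kp : k \notin path_edges G v p.
  apply: contra uvp => /path_edges_mem; apply.
  by rewrite e set21.
rewrite big_setU1 //= intrM -mulrA -IH //; last by apply: switchingS sw; apply: subsetUr.
by apply: sw e; rewrite setU11.
Qed.

Lemma cycle_edges_cons u p k : uniq (u :: p) -> edge G k = [set last u p; u] ->
  cycle_edges G (u :: p) = k |: path_edges G u p.
Proof.
move=> up e; apply/setP=> l; rewrite in_setU1 inE; apply/idP/idP.
  case/existsP=> x /andP[xp /eqP]; rewrite next_nth xp.
  have ip : (index x (u :: p) <= size p)%N by rewrite -ltnS index_mem.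
  move=> el; have xE : x = nth u (u :: p) (index x (u :: p)) by rewrite nth_index.
  move: (index x (u :: p)) ip xE el => i ip xE el.
  move: ip; rewrite leq_eqVlt => /orP[/eqP ip|ip]; apply/orP; [left|right].
    apply/eqP/(edge_eq el); rewrite e xE ip [nth u p _]nth_default //.
    by rewrite (last_nth u).
  by apply/path_edgesP; exists i => //; rewrite -xE.
case/predU1P=> [->|/path_edgesP[i ip el]]; apply/existsP.
  exists (last u p); rewrite mem_last next_nth mem_last e.
  by rewrite {3}(last_nth u) index_uniq //= nth_default.
have ip' : (i < size (u :: p))%N by rewrite ltnS ltnW.
exists (nth u (u :: p) i); rewrite mem_nth // next_nth.
by rewrite mem_nth // el index_uniq // eqxx.
Qed.

(** With at least three vertices the first and the last are not consecutive on the path; with two,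
    the path edge itself would close it. *)
Lemma closing_edge_notin u p k : uniq (u :: p) -> (1 < size p)%N ->
  edge G k = [set last u p; u] -> k \notin path_edges G u p.
Proof.
move=> up sp e; apply/negP=> /path_edgesP[i ip ek].
have le j : (j <= size p)%N -> (j < size (u :: p))%N by rewrite ltnS.
have : [set nth u (u :: p) i; nth u (u :: p) i.+1] = [set last u p; u] by rewrite -e ek.
rewrite (last_nth u) => /setP es.
have i0 : i = 0%N.
  have := es (nth u (u :: p) 0); rewrite !inE eqxx orbT !nth_uniq //; last first.
    by apply: le; apply: ltnW.
  by case: i {ip ek es} => [|i].
have := es (nth u (u :: p) (size p)); rewrite !inE eqxx orTb i0 !nth_uniq //.
  by case: (size p) sp => [|[]].
by apply: le; apply: ltnW.
Qed.

Lemma cycles_sub S C : C \in cycles G S -> C \subset S.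
Proof.
rewrite inE => /existsP[c /andP[/and3P[_ cc uc] /eqP ->]].
apply/subsetP=> k; rewrite inE => /existsP[x /andP[xc /eqP e]].
by have /adjP[l lS el] := next_cycle cc xc; rewrite (edge_eq e el).
Qed.

Lemma mem_cycles S u p k : path (adj G S) u p -> uniq (u :: p) ->
  (1 < size p)%N -> k \in S -> edge G k = [set last u p; u] ->
  k |: path_edges G u p \in cycles G S.
Proof.
move=> pp up sp kS e.
have sz : (size (u :: p) <= n)%N.
  by rewrite -(card_uniqP up) -[X in (_ <= X)%N](card_ord n) max_card.
rewrite inE; apply/existsP; exists (Bseq sz); rewrite -(cycle_edges_cons up e) eqxx andbT.
apply/and3P; split => //=; rewrite rcons_path pp /=.
by apply/adjP; exists k.
Qed.

(** The vertex list is rotated so that the chosen edge [k] becomes the closing one; a cycle can thus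
    be cut open at any of its edges. *)
Lemma cycle_path S C k : C \in cycles G S -> k \in C ->
  exists u p, [/\ uniq (u :: p), path (adj G S) u p,
    edge G k = [set last u p; u], k \notin path_edges G u p &
    C = k |: path_edges G u p].
Proof.
rewrite inE => /existsP[c /andP[/and3P[sc cc uc] /eqP ->]].
rewrite inE => /existsP[x /andP[xc /eqP e]].
have nxc : next c x \in c by rewrite mem_next.
case: (rot_to nxc) => i p rE; move: (next c x) e nxc rE (next_rot i uc x) => u e nxc rE.
have up : uniq (u :: p) by rewrite -rE rot_uniq.
have sp : (1 < size p)%N by move: sc; rewrite -(size_rot i) rE.
have cp : path.cycle (adj G S) (u :: p) by rewrite -rE rot_cycle.
rewrite rE => nx; have xp : x \in u :: p by rewrite -rE mem_rot.
have lx : last u p = x.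
  rewrite -[RHS](prev_next up) nx prev_nth mem_head.
  by move: up => /= /andP[/negPf un _]; rewrite memNindex ?un // (last_nth u).
move: e; rewrite -lx => e; exists u, p; split => //.
- by move: cp; rewrite /= rcons_path => /andP[].
- exact: closing_edge_notin.
rewrite -(cycle_edges_cons up e) -rE; apply/setP=> l; rewrite !inE.
by apply: eq_existsb => z; rewrite mem_rot next_rot.
Qed.

End Walks.

Section Cycles.
Variables (n m : nat) (G : signed_graph n m).
Implicit Types (S T H C : {set 'I_m}) (W Q : {set 'I_n}) (k l : 'I_m).

Lemma set2_eq (T : finType) (a b u v : T) : a != b -> [set a; b] = [set u; v] ->
  (u = a /\ v = b) \/ (u = b /\ v = a).
Proof.
move=> ab /setP e; have := e a; have := e b; rewrite !inE !eqxx orbT /=.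
have := e u; have := e v; rewrite !inE !eqxx orbT /=.
case/orP=> /eqP -> /orP[]/eqP ->; rewrite ?eqxx ?orbb; auto.
  by rewrite eq_sym (negPf ab).
by rewrite (negPf ab).
Qed.

Lemma cyclesW S S' C : C \in cycles G S -> C \subset S' -> C \in cycles G S'.
Proof.
rewrite !inE => /existsP[c /andP[/and3P[sc cc uc] /eqP ->]] /subsetP CS.
apply/existsP; exists c; rewrite eqxx andbT; apply/and3P; split => //.
apply: cycle_from_next => // x xc.
have /adjP[k kS e] := next_cycle cc xc; apply/adjP; exists k => //.
by apply: CS; rewrite inE; apply/existsP; exists x; rewrite xc e eqxx.
Qed.

Lemma cyclesS S S' : S \subset S' -> cycles G S \subset cycles G S'.
Proof.
move=> sS; apply/subsetP=> C CS; apply: cyclesW (CS) _.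
exact: subset_trans (cycles_sub CS) sS.
Qed.

Lemma balancedS S S' : S \subset S' -> balanced G S' -> balanced G S.
Proof.
move=> /cyclesS/subsetP sS /forallP b; apply/forallP=> C; apply/implyP=> /sS CS.
by have := b C; rewrite CS.
Qed.

Lemma cycle_nonempty S C : C \in cycles G S -> exists k, k \in C.
Proof.
rewrite inE => /existsP[c /andP[/and3P[sc cc uc] /eqP ->]].
case: (bseqval c) sc cc => // x p _ cc.
have xc : x \in x :: p by apply: mem_head.
have /adjP[k kS e] := next_cycle cc xc.
by exists k; rewrite inE; apply/existsP; exists x; rewrite xc e eqxx.
Qed.

Lemma cycle_connect S C k a b : C \in cycles G S -> k \in C ->
  edge G k = [set a; b] -> connect (adj G (C :\ k)) a b.
Proof.
move=> CS kC e; have [u [p [up pp e' kp CE]]] := cycle_path CS kC.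
have -> : C :\ k = path_edges G u p by rewrite CE setU1K.
have co : connect (adj G (path_edges G u p)) u (last u p).
  by apply/connectP; exists p => //; apply: path_on_edges pp.
move: e' (edge_neq e'); rewrite e => /esym e' /set2_eq/(_ e')[[-> ->]|[-> ->]] //.
by rewrite connect_adjC.
Qed.

(** A shortened path from [a] to [b] avoiding [k] has at least two edges, since no other edge has
    the same ends, and [k] closes it. Its contrapositive supplies all the bridges used below. *)
Lemma mem_cycle S k a b : k \in S -> edge G k = [set a; b] ->
  connect (adj G (S :\ k)) a b -> exists2 C, C \in cycles G S & k \in C.
Proof.
move=> kS e /connectP[p0 pp0 bE].
move: bE; case/shortenP: pp0 => p pp up _ bE; exists (k |: path_edges G a p).
  apply: mem_cycles => //.
  - by apply: sub_path pp; apply: adjS; apply: subD1set.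
  - case: p pp up bE => [|c [|d p]] //=.
      by move=> _ _ ba; move: (edge_neq e); rewrite ba eqxx.
    rewrite andbT => /adjP[l]; rewrite !inE => /andP[lk _] el _ bE.
    by case/eqP: lk; apply: edge_eq el _; rewrite -bE.
  - by rewrite -bE setUC.
by rewrite setU11.
Qed.

Lemma prod_sigma C :
  \prod_(k in C) sigma G k = (-1) ^+ #|[set k in C | negative G k]|.
Proof.
rewrite (bigID (negative G)) /= [X in _ * X]big1 ?mulr1 => [|k /andP[_]].
  rewrite -prodr_const; apply: eq_big => [k|k /andP[_ /eqP]//].
  by rewrite inE.
by rewrite /negative; case: (sigma_pm1 G k) => ->.
Qed.

Lemma balanced_prod C : balanced_cycle G C -> \prod_(k in C) sigma G k = 1.
Proof. by rewrite prod_sigma -signr_odd => /negPf ->. Qed.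

Lemma unbalanced_prod C : ~~ balanced_cycle G C -> \prod_(k in C) sigma G k = -1.
Proof. by rewrite prod_sigma -signr_odd negbK => ->. Qed.

(** * Switching functions and signs of paths *)

Section Switching.
Variable R : realFieldType.
Implicit Types x y : 'I_n -> R.

Lemma switching_sym k a b x : edge G k = [set a; b] ->
  x a = (sigma G k)%:~R * x b ->
  forall u v, edge G k = [set u; v] -> x u = (sigma G k)%:~R * x v.
Proof.
move=> e xa u v; rewrite e => /(set2_eq (edge_neq e))[[-> ->]//|[-> ->]].
by rewrite xa mulrA sigma_sqr mul1r.
Qed.

Lemma switchingD1 S k a b x : edge G k = [set a; b] ->
  switching G (S :\ k) x -> x a = (sigma G k)%:~R * x b -> switching G S x.
Proof.
move=> e sx xa l u v lS el; case: (eqVneq l k) => [lk|lk].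
  by rewrite lk in el *; exact: (switching_sym e xa el).
by apply: sx el; rewrite !inE lk.
Qed.

(** The conditions on the other edges of a cycle already determine how the values at the ends of [k]
    are related: as [k] demands if the cycle is balanced, with the opposite sign if it is
    unbalanced. *)
Lemma cycle_switching S C k a b x : C \in cycles G S -> k \in C ->
  edge G k = [set a; b] -> switching G (C :\ k) x ->
  x a = (\prod_(l in C) sigma G l)%:~R * (sigma G k)%:~R * x b.
Proof.
move=> CS kC e; have [u [p [up pp e' kp CE]]] := cycle_path CS kC.
have -> : C :\ k = path_edges G u p by rewrite CE setU1K.
move=> sw; have xu := switching_path pp up sw.
have pE : (\prod_(l in C) sigma G l)%:~R * (sigma G k)%:~R =
    (\prod_(l in path_edges G u p) sigma G l)%:~R :> R.
  by rewrite CE big_setU1 //= intrM mulrAC sigma_sqr mul1r.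
have p2 : (\prod_(l in path_edges G u p) sigma G l)%:~R ^+ 2 = 1 :> R.
  by rewrite prod_sigma rmorphXn /= mulrN1z -exprM mulnC exprM sqrrN expr1n expr1n.
rewrite pE; move: e' (edge_neq e'); rewrite e => /esym e' /set2_eq/(_ e')[[-> ->]|[-> ->]] //.
by rewrite xu mulrA -expr2 p2 mul1r.
Qed.

(** Induction on the number of edges. If the ends of the removed edge stay connected, a balanced
    cycle through it makes its condition automatic; otherwise the values on one side of it can be
    negated at will. *)
Lemma exists_switching S : balanced G S ->
  exists2 y : 'I_n -> R, switching G S y & forall v, y v ^+ 2 = 1.
Proof.
elim: {S}#|S| {-2}S (erefl #|S|) => [|c IH] S cS bS.
  exists (fun=> 1) => [k u v|v]; last by rewrite expr1n.
  by rewrite (cards0_eq cS) inE.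
have [k kS] : exists k, k \in S by apply/set0Pn; rewrite -card_gt0 cS.
have sS : S :\ k \subset S by apply: subD1set.
have [||y sy y2] := IH (S :\ k).
- by move: cS; rewrite (cardsD1 k) kS => -[].
- exact: balancedS bS.
have [a [b [ab e]]] := edge_ends G k.
case: (boolP (connect (adj G (S :\ k)) a b)) => [cab|cab].
  exists y => //; apply: (switchingD1 e) => //.
  have [C CS kC] := mem_cycle kS e cab.
  rewrite (cycle_switching CS kC e); last first.
    by apply: switchingS sy; apply/setSD/(cycles_sub CS).
  have := forallP bS C; rewrite CS /= => /balanced_prod ->.
  by rewrite mul1r.
(* The sign by which the component of [b] is multiplied so that the condition at [k] holds. *)
pose eps := y a * (sigma G k)%:~R * y b.
exists (fun v => if connect (adj G (S :\ k)) b v then eps * y v else y v); last first.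
  move=> v; case: ifP => // _; rewrite !exprMn !y2 expr2 sigma_sqr.
  by rewrite !mulr1.
apply: (switchingD1 e) => [l u v lS el|].
  have -> : connect (adj G (S :\ k)) b u = connect (adj G (S :\ k)) b v.
    apply: same_connect_r; first exact: connect_adjC.
    exact: edge_connect el.
  by case: ifP => _; rewrite (sy _ _ _ lS el) // mulrCA.
rewrite connect_adjC (negPf cab) connect0 /eps.
have -> : forall s p q : R, s * (p * s * q * q) = (s * s) * q ^+ 2 * p by move=> *; ring.
by rewrite sigma_sqr y2 !mul1r.
Qed.

Lemma switching_connect0 S x u v : switching G S x -> connect (adj G S) u v ->
  x u = 0 -> x v = 0.
Proof.
move=> sw /connectP[p pp ->]; elim: p u pp => [|w p IH] u //= /andP[/adjP[k kS e] pp] xu.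
apply: IH pp _; move: e; rewrite setUC => e.
by rewrite (sw _ _ _ kS e) xu mulr0.
Qed.

(** Each edge multiplies both functions by the same sign, which cancels in the product. *)
Lemma switching_connect S x y u v : switching G S x -> switching G S y ->
  connect (adj G S) u v -> x u * y u = x v * y v.
Proof.
move=> sx sy /connectP[p pp ->]; elim: p u pp => [|w p IH] u //= /andP[/adjP[k kS e] pp].
rewrite -(IH w pp) (sx _ _ _ kS e) (sy _ _ _ kS e).
by rewrite mulrACA sigma_sqr mul1r.
Qed.

(** One turn around the cycle gives [x a = - x a]. One edge is enough, as [switching_connect0]
    spreads the zero. *)
Lemma unbalanced_switching0 S C x : C \in cycles G S -> ~~ balanced_cycle G C ->
  switching G C x -> exists k a b, [/\ k \in C, edge G k = [set a; b], x a = 0 & x b = 0].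
Proof.
move=> CS nb sx; have [k kC] := cycle_nonempty CS.
have [a [b [ab e]]] := edge_ends G k.
have xa := sx _ _ _ kC e.
have := cycle_switching CS kC e (switchingS (subD1set _ _) sx).
rewrite (unbalanced_prod nb) mulrN1z mulN1r mulNr -xa => xa0.
have {}xa0 : x a = 0.
  by apply/eqP; rewrite -[_ == 0](mulrn_eq0 _ 2) mulr2n {1}xa0 addNr.
exists k, a, b; split=> //; move: e; rewrite setUC => e.
by rewrite (sx _ _ _ kC e) xa0 mulr0.
Qed.

Lemma shortest_path_uniq S v Q (p : n.-bseq 'I_n) :
  shortest_path_to G S v Q p -> uniq (v :: p).
Proof.
case/andP=> /andP[pp lp] /forallP sh.
move: lp; case: (shortenP pp) => [p' pp' up' sub] lp.
have sz : (size (v :: p') <= n)%N.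
  by rewrite -(card_uniqP up') -[X in (_ <= X)%N](card_ord n) max_card.
have := sh (Bseq (ltnW sz)); rewrite /path_to pp' lp /= => le.
(* By minimality [p] is no longer than its shortened version, whose vertices all occur in [p]; hence
   [p] repeats no vertex either. *)
apply: (@leq_size_uniq _ (v :: p') (v :: p)) => // z; rewrite !inE => /orP[->//|/sub ->].
by rewrite orbT.
Qed.

Lemma shortest_path_exists S v Q q : q \in Q -> connect (adj G S) v q ->
  exists p : n.-bseq 'I_n, shortest_path_to G S v Q p.
Proof.
move=> qQ /connectP[p0 pp0 qE]; move: qE.
case/shortenP: pp0 => p pp up _ qE.
have sz : (size (v :: p) <= n)%N.
  by rewrite -(card_uniqP up) -[X in (_ <= X)%N](card_ord n) max_card.
pose b0 : n.-bseq 'I_n := Bseq (ltnW sz).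
have b0P : path_to G S v Q b0 by rewrite /path_to pp /= -qE.
case: (@arg_minnP _ b0 (fun b : n.-bseq 'I_n => path_to G S v Q b)
  (fun b : n.-bseq 'I_n => size b) b0P) => b bP bmin.
exists b; rewrite /shortest_path_to bP; apply/forallP=> c; apply/implyP.
exact: bmin.
Qed.

(** The sign is read off from [y] at the two ends, so it does not matter which shortest path is
    picked. Conditions on [y] concern only what is reachable from [v]; this covers [Q] an edge with
    a single reachable end. *)
Lemma sgn_pathE S v Q y q :
  (forall l a b, l \in S -> edge G l = [set a; b] -> connect (adj G S) v a ->
     y a = (sigma G l)%:~R * y b) ->
  q \in Q -> connect (adj G S) v q -> y q ^+ 2 = 1 ->
  (forall q', q' \in Q -> connect (adj G S) v q' -> y q' = y q) ->
  (sgn_path G S v Q)%:~R = y v * y q.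
Proof.
move=> sy qQ vq y2 yQ; rewrite /sgn_path; case: pickP => [p sp|no]; last first.
  by have [p] := shortest_path_exists qQ vq; rewrite no.
have up := shortest_path_uniq sp; case/andP: sp => /andP[pp lp] _.
rewrite (@switching_path R _ _ _ _ _ _ y pp up).
  have /yQ -> // : last v p \in Q by [].
    by rewrite -mulrA -expr2 y2 mulr1.
  by apply/connectP; exists p.
move=> l a b lp' e; apply: (sy _ _ _ _ e).
  exact: (subsetP (path_edges_sub pp)).
apply: (path_connect pp); apply: path_edges_mem lp' _.
by rewrite e set21.
Qed.

End Switching.

(** [d] is the distance to the root, and [u] is the second vertex of a shortest walk to it: the rest
    of that walk bounds [d u]. *)
Lemma parent_edges S : exists d : 'I_n -> nat,
  forall v, v != fingraph.root (adj G S) v ->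
    exists k u, [/\ k \in S, edge G k = [set v; u] & (d u < d v)%N].
Proof.
pose P v c := [exists p : c.-tuple 'I_n,
  path (adj G S) v p && (last v p == fingraph.root (adj G S) v)].
have PP v p : path (adj G S) v p -> last v p = fingraph.root (adj G S) v -> P v (size p).
  by move=> pp lp; apply/existsP; exists (in_tuple p); rewrite pp lp eqxx.
have Pex v : exists c, P v c.
  have /connectP[p pp lp] := connect_root (adj G S) v.
  by exists (size p); apply: PP.
exists (fun v => ex_minn (Pex v)) => v vr.
case: (ex_minnP (Pex v)) => c /existsP[p /andP[pp /eqP lp]] _.
have sp := size_tuple p.
case: (tval p) sp pp lp => [|u q] /= sq; first by move=> _ e; rewrite -e eqxx in vr.
case/andP=> /adjP[k kS e] pq lq; exists k, u; split => //.
case: ex_minnP => d _ /(_ (size q)) mind; rewrite -sq ltnS; apply: mind.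
apply: PP => //; rewrite lq.
by apply/(fingraph.rootP (connect_adjC _ S))/(edge_connect kS e).
Qed.

End Cycles.

(** * Left annihilators of the incidence columns *)

Section IncidenceRows.
Variables (R : realFieldType) (n m : nat) (G : signed_graph n m) (N : 'M[R]_(n, m)).
Hypothesis hN : is_incidence G N.
Implicit Types (S : {set 'I_m}) (k l : 'I_m) (x : 'I_n -> R).

Lemma incidence_sqr k v : v \in edge G k -> N v k * N v k = 1.
Proof.
have [_ h _] := hN k; case/h=> ->; first by rewrite mulr1.
by rewrite mulrNN mulr1.
Qed.

Lemma incidence_other k u v : edge G k = [set u; v] ->
  N v k = - (sigma G k)%:~R * N u k.
Proof.
move=> e; have [_ _ h] := hN k; have := h _ _ (edge_neq e) e.
rewrite /negative; case: (sigma_pm1 G k) => -> /=; last by rewrite opprK mul1r => ->.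
by move=> ->; rewrite mulrN mulN1r opprK.
Qed.

Lemma incidence_sum k u v x : edge G k = [set u; v] ->
  \sum_w x w * N w k = x u * N u k + x v * N v k.
Proof.
move=> e; have uv := edge_neq e.
rewrite (bigD1 u) //= (bigD1 v) 1?eq_sym //= big1 ?addr0 // => w /andP[wu wv].
have [h _ _] := hN k; rewrite h ?mulr0 // e !inE.
by rewrite (negPf wu) (negPf wv).
Qed.

Lemma incidence_sumE k u v x : edge G k = [set u; v] ->
  \sum_w x w * N w k = N u k * (x u - (sigma G k)%:~R * x v).
Proof.
move=> e; rewrite (incidence_sum _ e) (incidence_other e) mulrBr mulrC.
by rewrite mulNr mulrN; congr (_ - _); rewrite mulrC mulrAC mulrC mulrA.
Qed.

Lemma incidence_annihP k u v x : edge G k = [set u; v] ->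
  (\sum_w x w * N w k = 0) <-> (x u = (sigma G k)%:~R * x v).
Proof.
move=> e; rewrite (incidence_sumE _ e); split=> [/eqP|->]; last by rewrite subrr mulr0.
rewrite mulf_eq0 subr_eq0 => /orP[/eqP N0|/eqP//].
have := @incidence_sqr k u; rewrite N0 mul0r e set21 => /(_ isT)/eqP.
by rewrite eq_sym oner_eq0.
Qed.

Lemma annih_switching S x : annih (fun v l => N v l) S x <-> switching G S x.
Proof.
split=> [h k u v kS e|h l lS]; first exact/(incidence_annihP _ e)/h.
have [u [v [_ e]]] := edge_ends G l.
exact/(incidence_annihP _ e)/(h _ _ _ lS e).
Qed.

Lemma laplacianE : laplacian G R = N *m N^T.
Proof.
apply/matrixP=> i j; rewrite !mxE; case: eqVneq => [<-|ij].
  case: pickP => [k /eqP /edge_neq|_]; first by rewrite eqxx.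
  rewrite subr0 /degree -sum1_card natr_sum mulr1n big_mkcond /=.
  apply: eq_bigr => k _; rewrite !mxE inE; case: ifP => ik; first by rewrite incidence_sqr.
  by have [h _ _] := hN k; rewrite h ?ik // mul0r.
rewrite mulr0n add0r.
have zero k : edge G k != [set i; j] -> N i k * N^T k j = 0.
  move=> ne; rewrite mxE; have [h _ _] := hN k.
  case: (boolP (i \in edge G k)) => [ik|ik]; last by rewrite (h i) // mul0r.
  case: (boolP (j \in edge G k)) => [jk|jk]; last by rewrite (h j) // mulr0.
  case/eqP: ne; apply/esym/eqP; rewrite eqEcard edge_card cards2 ij andbT.
  by apply/subsetP=> v /set2P[]->.
case: pickP => [k /eqP e|no].
  rewrite (bigD1 k) //= big1 ?addr0 => [|l lk]; last first.
    by apply: zero; apply: contra lk => /eqP el; apply/eqP/(edge_eq el e).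
  by rewrite mxE (incidence_other e) mulrCA incidence_sqr ?mulr1 // e set21.
by rewrite oppr0 big1 // => k _; apply: zero; rewrite no.
Qed.

End IncidenceRows.

(** * Unicyclic components *)

Section Components.
Variables (n m : nat) (G : signed_graph n m).
Implicit Types (S H C : {set 'I_m}) (W : {set 'I_n}) (k l : 'I_m).

Lemma mem_component S u v : (v \in component G S u) = connect (adj G S) u v.
Proof. by rewrite inE. Qed.

Lemma component_edge S u k a b : k \in S -> edge G k = [set a; b] ->
  (a \in component G S u) = (b \in component G S u).
Proof.
move=> kS e; rewrite !mem_component.
by apply: same_connect_r; [apply: connect_adjC|apply: edge_connect e].
Qed.

Lemma eq_component S u v : v \in component G S u -> component G S v = component G S u.
Proof.
rewrite mem_component => uv; apply/setP=> w; rewrite !mem_component.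
by apply/esym/same_connect => //; apply: connect_adjC.
Qed.

Lemma mem_restr S u k a b : k \in S -> edge G k = [set a; b] ->
  a \in component G S u -> k \in restr G S (component G S u).
Proof.
move=> kS e aW; rewrite inE kS e; apply/subsetP=> v /set2P[]->//.
by rewrite -(component_edge _ kS e).
Qed.

Lemma restr_sub S W : restr G S W \subset S.
Proof. by apply/subsetP=> k; rewrite inE => /andP[]. Qed.

Lemma mem_restr_edge S W k v : k \in restr G S W -> v \in edge G k -> v \in W.
Proof. by rewrite inE => /andP[_ /subsetP]; apply. Qed.

Lemma connect_restr S u a b : a \in component G S u -> connect (adj G S) a b ->
  connect (adj G (restr G S (component G S u))) a b.
Proof.
move=> aW /connectP[p pp ->]; elim: p a aW pp => [|c p IH] a aW //=.
case/andP=> /adjP[k kS e] pp; apply: connect_trans (IH c _ pp).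
  by apply: edge_connect (e); apply: mem_restr e aW.
by rewrite -(component_edge _ kS e).
Qed.

Lemma connectD1 S k a b : edge G k = [set a; b] -> connect (adj G (S :\ k)) a b ->
  subrel (connect (adj G S)) (connect (adj G (S :\ k))).
Proof.
move=> e cab; apply: connect_sub => u v /adjP[l lS el].
case: (eqVneq l k) => [lk|lk]; last by apply: edge_connect el; rewrite !inE lk.
move: el; rewrite lk e => /(set2_eq (edge_neq e))[[-> ->]//|[-> ->]].
by rewrite connect_adjC.
Qed.

Lemma connect_split S k a b u : edge G k = [set a; b] -> connect (adj G S) u a ->
  connect (adj G (S :\ k)) u a \/ connect (adj G (S :\ k)) u b.
Proof.
move=> e /connectP[p pp aE]; elim: p u pp aE => [|w p IH] u /=.
  by move=> _ <-; left; apply: connect0.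
case/andP=> /adjP[l lS el] pp aE; case: (eqVneq l k) => [lk|lk].
  move: el; rewrite lk e => /(set2_eq (edge_neq e))[[-> _]|[-> _]].
    by left; apply: connect0.
  by right; apply: connect0.
have uw : connect (adj G (S :\ k)) u w by apply: edge_connect el; rewrite !inE lk.
by case: (IH w pp aE) => h; [left|right]; apply: connect_trans uw h.
Qed.

Lemma cycle_vertices S C l l' u v : C \in cycles G S -> l \in C -> l' \in C ->
  u \in edge G l -> v \in edge G l' -> connect (adj G S) u v.
Proof.
rewrite inE => /existsP[c /andP[/and3P[sc cc uc] /eqP ->]].
have inc k w : k \in cycle_edges G c -> w \in edge G k -> w \in (c : seq 'I_n).
  rewrite inE => /existsP[x /andP[xc /eqP ->]] /set2P[]-> //.
  by rewrite mem_next.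
by move=> lC l'C ul vl'; apply: (connect_cycle cc); [apply: inc ul|apply: inc vl'].
Qed.

Lemma acyclic_balanced S : cycles G S = set0 -> balanced G S.
Proof. by move=> c0; apply/forallP=> C; rewrite c0 inE. Qed.

Lemma not_balanced S : ~~ balanced G S ->
  exists2 C, C \in cycles G S & ~~ balanced_cycle G C.
Proof.
by rewrite negb_forall => /existsP[C]; rewrite negb_imply => /andP[]; exists C.
Qed.

Lemma component_comps S u : component G S u \in comps G S.
Proof. exact: imset_f. Qed.

End Components.

Section Unicyclic.
Variables (R : realFieldType) (n m : nat) (G : signed_graph n m) (N : 'M[R]_(n, m)).
Hypothesis hN : is_incidence G N.
Implicit Types (S H C : {set 'I_m}) (W : {set 'I_n}) (k l : 'I_m).
Let A v l := N v l.

Lemma rigid_switching S : rigid A S <->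
  forall x : 'I_n -> R, switching G S x -> forall v, x v = 0.
Proof.
by split=> h x; [move/(annih_switching hN)|move=> ax]; apply: h => //;
  apply/(annih_switching hN).
Qed.

(** The sign function of a balanced component, extended by zero, would be a nonzero kernel
    vector. *)
Lemma rigid_unbalanced H u : rigid A H -> ~~ balanced G (restr G H (component G H u)).
Proof.
move=> /rigid_switching rH; apply/negP=> bal.
have [y sy y2] := exists_switching R bal.
have := rH (fun v => if v \in component G H u then y v else 0).
have sw : switching G H (fun v => if v \in component G H u then y v else 0).
  move=> k a b kH e /=; rewrite (component_edge _ kH e).
  case: ifP => bW; last by rewrite mulr0.
  by apply: sy (e); apply: mem_restr (e) _; rewrite // (component_edge _ kH e).
move/(_ sw u); rewrite mem_component connect0 => yu.
by have := y2 u; rewrite yu expr0n => /eqP; rewrite eq_sym oner_eq0.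
Qed.

(** With exactly n columns there is no slack: an edge whose condition follows from the others could
    be dropped, leaving a rigid set of n - 1 columns. *)
Lemma rigid_minimal H k : #|H| = n -> rigid A H -> k \in H ->
  ~ (forall x : 'I_n -> R, switching G (H :\ k) x -> switching G H x).
Proof.
move=> cH /rigid_switching rH kH ext.
have /rigid_card : rigid A (H :\ k) by apply/rigid_switching=> x /ext; apply: rH.
by rewrite -cH (cardsD1 k H) kH ltnn.
Qed.

Lemma rigid_TUn H : #|H| = n -> rigid A H -> H \in TUn G.
Proof.
move=> cH rH; rewrite inE cH eqxx; apply/forallP=> W; apply/implyP.
case/imsetP=> u _ ->; apply/orP; right; have nb := rigid_unbalanced u rH.
set W0 := component G H u in nb *; set U := restr G H W0 in nb *.
have UH : U \subset H by apply: restr_sub.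
rewrite /unbalanced_unicyclic_comp nb andbT; apply/andP; split.
  apply/forallP=> a; apply/implyP=> aW; apply/forallP=> b; apply/implyP=> bW.
  apply: connect_restr => //; rewrite mem_component in aW; rewrite mem_component in bW.
  by apply: connect_trans bW; rewrite connect_adjC.
(* A balanced cycle would make the condition of each of its edges redundant. *)
have unb C : C \in cycles G U -> ~~ balanced_cycle G C.
  move=> CU; apply/negP=> /balanced_prod pC; have [k kC] := cycle_nonempty CU.
  have kH : k \in H by apply/(subsetP UH)/(subsetP (cycles_sub CU)).
  apply: (rigid_minimal cH rH kH) => x sx; have [a [b [ab e]]] := edge_ends G k.
  apply: (switchingD1 e sx); rewrite (cycle_switching CU kC e) ?pC ?mul1r //.
  by apply: switchingS sx; apply/setSD/(subset_trans (cycles_sub CU)).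
(* Suppose [k] lies on [C] but not on [C0]. Without [k], the unbalanced [C0] still forces zeros, and
   the rest of [C] keeps the component connected, so the zeros reach both ends of [k] and its
   condition is redundant. *)
have sub C C0 : C \in cycles G U -> C0 \in cycles G U -> C \subset C0.
  move=> CU C0U; apply/subsetP=> k kC; apply/negPn/negP=> kC0.
  have kU := subsetP (cycles_sub CU) _ kC.
  have kH : k \in H by apply/(subsetP UH).
  apply: (rigid_minimal cH rH kH) => x sx; have [a [b [ab e]]] := edge_ends G k.
  have C0k : C0 \subset H :\ k.
    by rewrite subsetD1 kC0 andbT; apply: subset_trans (cycles_sub C0U) UH.
  have [l [c [d [lC0 el xc _]]]] :=
    unbalanced_switching0 C0U (unb _ C0U) (switchingS C0k sx).
  have cab : connect (adj G (H :\ k)) a b.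
    apply: connectS (cycle_connect CU kC e).
    by apply/setSD/(subset_trans (cycles_sub CU)).
  have z v : v \in edge G k -> x v = 0.
    move=> vk; apply: (switching_connect0 sx) xc; apply: (connectD1 e cab).
    have : v \in W0 by apply: mem_restr_edge kU vk.
    have : c \in W0.
      apply: (mem_restr_edge (subsetP (cycles_sub C0U) _ lC0)).
      by rewrite el set21.
    rewrite !mem_component => uc uv; apply: connect_trans uv.
    by rewrite connect_adjC.
  by apply: (switchingD1 e sx); rewrite !z ?mulr0 // e ?set21 ?set22.
have [C0 C0U _] := not_balanced nb.
apply/cards1P; exists C0; apply/setP=> C; rewrite inE.
apply/idP/eqP => [CU|->//]; apply/eqP; rewrite eqEsubset.
by rewrite !sub.
Qed.

(** The orientation conventions collapse to one fact: for either sign of the edge, its weight is the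
    entry of [N] at the tail. *)
Lemma tail_head k : exists t h, [/\ edge G k = [set t; h],
  forall v, is_tail G N k v = (v == t), forall v, is_head G N k v = (v == h)
  & edge_w G N k = N t k].
Proof.
have [a [b [ab e]]] := edge_ends G k; rewrite /is_tail /is_head /edge_w.
have [_ h1 _] := hN k.
have ne : (1 == -1 :> R) = false.
  by rewrite -subr_eq0 opprK -mulr2n mulrn_eq0 oner_eq0.
case: (boolP (positive G k)) => [pk|pk].
  have -> : negative G k = false by rewrite /negative (eqP pk).
  wlog Na : a b ab e / N a k = 1.
    move=> hw; have : a \in edge G k by rewrite e set21.
    case/h1=> Na; first exact: (hw a b).
    apply: (hw b a); rewrite 1?eq_sym // 1?setUC // (incidence_other hN e).
    by rewrite (eqP pk) mulN1r Na opprK.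
  have Nb : N b k = -1 by rewrite (incidence_other hN e) (eqP pk) Na mulr1.
  exists a, b; rewrite Na; split=> // v; rewrite e !inE.
    case: (eqVneq v a) => [->|va]; first by rewrite Na eqxx.
    by case: (eqVneq v b) => [->|vb] //; rewrite Nb eq_sym ne.
  case: (eqVneq v b) => [->|vb]; first by rewrite Nb eqxx orbT.
  by case: (eqVneq v a) => [->|va] //; rewrite Na ne.
have nk : negative G k.
  by move: pk; rewrite /positive /negative; case: (sigma_pm1 G k) => ->.
wlog lab : a b ab e / (a < b)%N.
  move=> hw; case: (ltngtP a b) => [|lt|/val_inj ab']; first exact: hw.
    by apply: (hw b a); rewrite 1?eq_sym // setUC.
  by rewrite ab' eqxx in ab.
have Nab : N b k = N a k.
  by rewrite (incidence_other hN e) (eqP nk) opprK mul1r.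
have ends (P : pred 'I_n) : [forall u in edge G k, P u] = P a && P b.
  apply/forallP/andP=> [h|[Pa Pb] u].
    by split; apply: (implyP (h _)); rewrite e ?set21 ?set22.
  by apply/implyP; rewrite e => /set2P[]->.
exists a, b; split=> //.
- move=> v; rewrite ends e !inE.
  case: (eqVneq v a) => [->|va]; first by rewrite leqnn ltnW.
  by case: (eqVneq v b) => [->|vb] //=; rewrite leqNgt lab.
- move=> v; rewrite ends e !inE.
  case: (eqVneq v b) => [->|vb]; first by rewrite leqnn orbT ltnW.
  by case: (eqVneq v a) => [->|va] //=; rewrite leqnn leqNgt lab.
rewrite nk ends Nab andbb /=; have : a \in edge G k by rewrite e set21.
by case/h1=> ->; rewrite ?eqxx // ne.
Qed.

Lemma restr_dual H u k (x : 'I_n -> R) :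
  let W := component G H u in
  k \in restr G H W -> (forall v, v \notin W -> x v = 0) ->
  (forall l, l \in restr G H W -> \sum_v x v * N v l = (k == l)%:R) ->
  forall l, l \in H -> \sum_v x v * N v l = (k == l)%:R.
Proof.
move=> W kU x0 xU l lH; case: (boolP (l \in restr G H W)) => [/xU//|lU].
have -> : (k == l) = false by apply: contraNF lU => /eqP <-.
have [a [b [_ e]]] := edge_ends G l; rewrite (incidence_sum hN _ e).
have aW : a \notin W by apply: contra lU => aW; apply: mem_restr e aW.
have bW : b \notin W by rewrite -(component_edge _ lH e).
by rewrite !x0 // !mul0r addr0.
Qed.

(** Extended by zero beyond [B], the function [y] meets every condition except that of the bridge
    [k], the only edge leaving [B]. The factor [N a k * y a] normalizes the remaining pairing to
    1. *)
Lemma bridge_dual S k a b (y : 'I_n -> R) : k \in S -> edge G k = [set a; b] ->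
  ~~ connect (adj G (S :\ k)) a b ->
  let B := component G (S :\ k) a in
  switching G (restr G S B) y -> y a ^+ 2 = 1 ->
  forall l, l \in S ->
    \sum_v (if v \in B then N a k * y a * y v else 0) * N v l = (k == l)%:R.
Proof.
move=> kS e ncab B sy ya l lS; case: (eqVneq k l) => [<-|kl].
  rewrite (incidence_sum hN _ e) !mem_component connect0 (negPf ncab) mul0r addr0.
  rewrite -(mulrA (N a k)) -expr2 ya mulr1 (incidence_sqr hN) //.
  by rewrite e set21.
have [c [d [_ el]]] := edge_ends G l; apply/(incidence_annihP hN _ el).
have lS' : l \in S :\ k by rewrite !inE eq_sym kl.
rewrite (component_edge _ lS' el); case: ifP => dB; last by rewrite mulr0.
rewrite (sy l c d _ el) 1?mulrCA // inE lS el; apply/subsetP=> v /set2P[]->//.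
by rewrite (component_edge _ lS' el).
Qed.

Lemma comp_of_edgeE H k a : k \in H -> a \in edge G k ->
  comp_of_edge G H k = component G H a.
Proof.
move=> kH ak; apply/setP=> v; apply/bigcupP/idP => [[u uk]|vW]; last by exists a.
rewrite !mem_component; apply: connect_trans.
have [c [d [_ e]]] := edge_ends G k.
have cd := edge_connect kH e; have dc := cd; rewrite connect_adjC in dc.
by move: ak uk; rewrite e => /set2P[]-> /set2P[]-> //; apply: connect0.
Qed.

(** Existence of some dual row is all that the proof of rigidity asks for a tree component. *)
Lemma tree_dual H k : k \in H ->
  is_tree G (comp_of_edge G H k) (restr G H (comp_of_edge G H k)) ->
  exists x : 'I_n -> R, forall l, l \in H -> \sum_v x v * N v l = (k == l)%:R.
Proof.
move=> kH; have [a [b [_ e]]] := edge_ends G k.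
have ak : a \in edge G k by rewrite e set21.
rewrite (comp_of_edgeE kH ak); set W := component G H a; set U := restr G H W.
case/andP=> _ /eqP c0.
have kU : k \in U by apply: mem_restr e _; rewrite // mem_component connect0.
have ncab : ~~ connect (adj G (U :\ k)) a b.
  by apply/negP=> /(mem_cycle kU e)[C]; rewrite c0 inE.
set B := component G (U :\ k) a.
have [|y sy y2] := @exists_switching _ _ G R (restr G U B).
  by apply: balancedS (acyclic_balanced c0); apply: restr_sub.
exists (fun v => if v \in B then N a k * y a * y v else 0).
apply: (restr_dual kU) => [v vW|]; last exact: (bridge_dual kU e ncab sy (y2 a)).
rewrite ifN //; apply: contra vW; rewrite !mem_component.
by apply: connectS; apply: subset_trans (restr_sub _ _ _); apply: subD1set.
Qed.

(** For [k] on the cycle, the row is a sign function of the tree left after cutting at [k].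
    Otherwise [k] is a bridge and the row is that of [bridge_dual], supported on the side away from
    the cycle. *)
Lemma formula_dual H k : k \in H -> unbalanced_unicyclic_comp G H (comp_of_edge G H k) ->
  forall l, l \in H -> \sum_v NH_formula G N H k v * N v l = (k == l)%:R.
Proof.
move=> kH; have [t [h [e tailE headE wE]]] := tail_head k.
have tk : t \in edge G k by rewrite e set21.
rewrite /unbalanced_unicyclic_comp /NH_formula (comp_of_edgeE kH tk).
set W := component G H t; set U := restr G H W.
case/andP=> /andP[/forallP conU /cards1P[C cU]] nbU.
have CU : C \in cycles G U by rewrite cU inE.
have -> : the_cycle G U = C.
  by rewrite /the_cycle; case: pickP => [C'|/(_ C)]; rewrite cU inE ?eqxx // => /eqP.
have nbC : ~~ balanced_cycle G C.
  by have [C' ] := not_balanced nbU; rewrite cU inE => /eqP ->.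
have kU : k \in U by apply: mem_restr e _; rewrite // mem_component connect0.
have tW : t \in W by rewrite mem_component connect0.
have conW u v : u \in W -> v \in W -> connect (adj G U) u v.
  by move=> uW vW; have /implyP/(_ uW)/forallP/(_ v)/implyP/(_ vW) := conU u.
have headC v : (v \in head_comp G N U k) = connect (adj G (U :\ k)) h v.
  rewrite /head_comp (big_pred1 h) ?mem_component // => u; exact: headE.
apply: (restr_dual kU) => [v ->//|].
case: (boolP (k \in C)) => [kC|kC].
  have c0 : cycles G (U :\ k) = set0.
    apply/setP=> C'; rewrite [RHS]inE; apply/negP=> C'U.
    have := subsetP (cyclesS G (subD1set U k)) _ C'U; rewrite cU inE => /eqP C'C.
    by have := subsetP (cycles_sub C'U) k; rewrite C'C !inE eqxx => /(_ kC).
  have [y sy y2] := exists_switching R (acyclic_balanced c0).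
  have cth : connect (adj G (U :\ k)) t h.
    by apply: connectS (cycle_connect CU kC e); exact: setSD (cycles_sub CU).
  have sgnE v : v \in W ->
      (sgn_path G (U :\ k) v [set t0 | is_tail G N k t0])%:~R = y v * y t.
    move=> vW; apply: sgn_pathE => //.
    - by move=> l a b lU el _; apply: sy el.
    - by rewrite inE tailE.
    - by apply: (connectD1 e cth); apply: conW.
    - by move=> q; rewrite inE tailE => /eqP ->.
  (* Since the cycle is unbalanced, the two ends contribute equally to the pairing with column [k];
     this is the origin of the factor 1/2. *)
  have yt : y t = - (sigma G k)%:~R * y h.
    rewrite (cycle_switching CU kC e) ?(unbalanced_prod nbC) ?mulrN1z ?mulN1r //.
    by apply: switchingS sy; exact: setSD (cycles_sub CU).
  have fE v : v \in W -> (if v \notin W then 0 else edge_w G N k * (2^-1 *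
       (sgn_path G (U :\ k) v [set t0 | is_tail G N k t0])%:~R)) = N t k * 2^-1 * y t * y v.
    by move=> vW; rewrite vW sgnE // wE; ring.
  move=> l lU; have [c [d [_ el]]] := edge_ends G l.
  have inW w : w \in edge G l -> w \in W by apply: mem_restr_edge lU.
  case: (eqVneq k l) => [kl|kl].
    rewrite -kl (incidence_sum hN _ e) !fE ?tW //; last first.
      by apply: mem_restr_edge kU _; rewrite e set22.
    have yh : y h = - (sigma G k)%:~R * y t.
      by rewrite yt mulrA mulrNN sigma_sqr mul1r.
    rewrite (incidence_other hN e) yh.
    have -> : forall p q s : R, p * 2^-1 * q * q * p + p * 2^-1 * q * (- s * q) * (- s * p)
       = 2^-1 * (q ^+ 2) * (p * p) * (1 + s * s) by move=> *; ring.
    rewrite y2 (incidence_sqr hN tk) sigma_sqr !mulr1 mulVf //.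
    by rewrite pnatr_eq0.
  apply/(incidence_annihP hN _ el); rewrite !fE ?inW ?el ?set21 ?set22 //.
  rewrite (sy l c d _ el) ?mulrA; last by rewrite in_setD1 eq_sym kl.
  by ring.
have CUk : C \in cycles G (U :\ k).
  by apply: cyclesW (CU) _; rewrite subsetD1 kC andbT; exact: (cycles_sub CU).
have [l0 l0C] := cycle_nonempty CU.
have [u0 [u1 [_ e0]]] := edge_ends G l0.
have u0l : u0 \in edge G l0 by rewrite e0 set21.
have ccE v : (v \in cycle_comp G U k C) = connect (adj G (U :\ k)) u0 v.
  apply/bigcupP/idP => [[l lC /bigcupP[u ul]]|uv].
    by rewrite mem_component; apply: connect_trans; apply: cycle_vertices CUk _ _ u0l ul.
  by exists l0 => //; apply/bigcupP; exists u0; rewrite // mem_component.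
have u0W : u0 \in W by apply: mem_restr_edge (subsetP (cycles_sub CU) _ l0C) u0l.
have ncth : ~~ connect (adj G (U :\ k)) t h.
  by apply/negP=> /(mem_cycle kU e)[C']; rewrite cU inE => /eqP ->; apply/negP.
(* [a] is the end of [k] away from the cycle. The minus sign for a positive edge whose head is [a]
   turns the entry at the tail into [N a k]. *)
have [a [b [eab u0b ak awE]]] : exists a b, [/\ edge G k = [set a; b],
    connect (adj G (U :\ k)) u0 b, a \in edge G k &
    edge_w G N k * (if positive G k && (h == a) then -1 else 1) = N a k].
  case: (connect_split e (conW _ _ u0W tW)) => [u0t|u0h].
    exists h, t; split; rewrite // 1?setUC // ?e ?set22 // eqxx andbT wE.
    rewrite (incidence_other hN e).
    case: ifP => [/eqP ->|pk]; first by rewrite mulN1r mulrN1.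
    rewrite mulr1; move: pk; rewrite /positive.
    by case: (sigma_pm1 G k) => -> // _; rewrite opprK mul1r.
  exists t, h; split=> //; rewrite eq_sym (negPf (edge_neq e)) andbF mulr1.
  exact: wE.
have ncab : ~~ connect (adj G (U :\ k)) a b.
  move: eab ncth; rewrite e => /(set2_eq (edge_neq e))[[-> ->]//|[-> ->]].
  by rewrite connect_adjC.
set B := component G (U :\ k) a.
have u0B : u0 \notin B.
  rewrite mem_component; apply: contra ncab => au0; exact: connect_trans au0 u0b.
have [|y sy y2] := @exists_switching _ _ G R (restr G U B).
  (* The only cycle passes through [u0], which is not on the side of [a]. *)
  apply: acyclic_balanced; apply/setP=> C'; rewrite [RHS]inE; apply/negP=> C'B.
  have := subsetP (cyclesS G (restr_sub G U B)) _ C'B; rewrite cU inE => /eqP C'C.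
  rewrite C'C in C'B; case/negP: u0B.
  exact: mem_restr_edge (subsetP (cycles_sub C'B) _ l0C) u0l.
have BW v : v \in B -> v \in W.
  rewrite !mem_component => av; have : connect (adj G H) a v.
    by apply: connectS av; apply: subset_trans (restr_sub G H W); apply: subD1set.
  apply: connect_trans; have : a \in W by apply: mem_restr_edge kU ak.
  by rewrite mem_component.
have aB : a \in B by rewrite mem_component connect0.
move=> l lU; rewrite -(bridge_dual kU eab ncab sy (y2 a) lU).
apply: eq_bigr => v _; congr (_ * _).
case: (boolP (v \in W)) => vW /=; last first.
  by rewrite ifN //; apply: contra vW; apply: BW.
have aW := BW _ aB.
rewrite ccE; case: (boolP (v \in B)) => vB; last first.
  suff -> : connect (adj G (U :\ k)) u0 v by rewrite mulr0.
  case: (connect_split eab (conW _ _ vW aW)) => cv.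
    by move: vB; rewrite mem_component connect_adjC cv.
  by apply: connect_trans u0b _; rewrite connect_adjC.
have av : connect (adj G (U :\ k)) a v by rewrite -mem_component.
have va : connect (adj G (U :\ k)) v a by rewrite connect_adjC.
have -> : connect (adj G (U :\ k)) u0 v = false.
  apply/negP=> u0v; case/negP: u0B; rewrite mem_component connect_adjC.
  exact: connect_trans u0v va.
have sgnE : (sgn_edge_path G U k v)%:~R = y v * y a.
  apply: sgn_pathE => //.
  - move=> l' c d l'U el' vc; apply: sy (el').
    have cB : c \in B by rewrite mem_component; apply: connect_trans av vc.
    rewrite inE el' (subsetP (subD1set U k)) //; apply/subsetP=> w /set2P[]->//.
    by rewrite -(component_edge _ l'U el').
  - move=> q; rewrite eab => /set2P[]->// vb.
    by case/negP: ncab; apply: connect_trans av vb.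
have -> : (v \in head_comp G N U k) = (h == a).
  rewrite headC; apply/idP/eqP => [hv|->//].
  have hE : h \in edge G k by rewrite e set22.
  move: hE; rewrite eab => /set2P[]// hb; case/negP: ncab.
  by apply: connect_trans av _; rewrite connect_adjC -hb.
rewrite -awE sgnE; case: ifP => _; ring.
Qed.

End Unicyclic.

(** * The unbalanced case *)

Section Unbalanced.
Variables (R : realFieldType) (n m : nat) (G : signed_graph n m) (N : 'M[R]_(n, m)).
Hypothesis hN : is_incidence G N.
Implicit Types (S H C : {set 'I_m}) (W : {set 'I_n}) (k l : 'I_m).
Let A v l := N v l.

Lemma comp_of_edge_comps H k : k \in H -> comp_of_edge G H k \in comps G H.
Proof.
move=> kH; have [a [b [_ e]]] := edge_ends G k.
by rewrite (@comp_of_edgeE _ _ _ _ _ a kH) ?component_comps // e set21.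
Qed.

(** A dual row for every edge gives a left inverse, and since [#|H| = n] the submatrix is square. *)
Lemma TUn_rigid H : H \in TUn G -> rigid A H.
Proof.
rewrite inE => /andP[/eqP cH /forallP tu].
have [k|X dX] := @fin_all_exists 'I_m _ (fun k (x : 'I_n -> R) =>
    k \in H -> forall l, l \in H -> \sum_v x v * N v l = (k == l)%:R).
  case: (boolP (k \in H)) => kH; last by exists (fun=> 0).
  have := tu (comp_of_edge G H k); rewrite comp_of_edge_comps //= => /orP[].
    by move/(tree_dual hN kH)=> [x xP]; exists x.
  by move/(formula_dual hN kH) => fP; exists (NH_formula G N H k).
by apply: (@dual_rows_rigid _ _ _ _ _ X) => // k l kH; apply: dX.
Qed.

Lemma TUn_unicyclic H u : H \in TUn G ->
  unbalanced_unicyclic_comp G H (component G H u).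
Proof.
move=> HT; have nb := rigid_unbalanced hN u (TUn_rigid HT).
move: HT; rewrite inE => /andP[_ /forallP/(_ (component G H u))].
rewrite component_comps /= => /orP[/andP[_ /eqP /acyclic_balanced b]|//].
by rewrite b in nb.
Qed.

Lemma TUn_dual H : H \in TUn G -> dual_rows A H (NH_formula G N H).
Proof.
move=> HT k l kH; apply: (formula_dual hN) => //.
have [a [b [_ e]]] := edge_ends G k.
by rewrite (@comp_of_edgeE _ _ _ _ _ a kH) ?TUn_unicyclic // e set21.
Qed.

(** The submatrix is square and invertible, and a two-sided inverse satisfies the Penrose
    equations. *)
Lemma NH_pinvE H k v : H \in TUn G -> k \in H ->
  NH_pinv N H k v = NH_formula G N H k v.
Proof.
move=> HT kH; rewrite /NH_pinv; case: pickP => [l /eqP lk|]; last first.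
  by move/(_ (enum_rank_in kH k)); rewrite enum_rankK_in ?eqxx.
have cH : n = #|H| by move: HT; rewrite inE => /andP[/eqP].
have subE : sub_incidence N H = subcols A H by apply/matrixP=> i j; rewrite !mxE.
have XA := dual_rowsE (TUn_dual HT); have AX := mulmx1_comm cH XA.
rewrite (@mpinv_uniq _ _ _ _ _ (rows H (NH_formula G N H)) (mpinvP _)).
  by rewrite mxE lk.
by rewrite subE /is_mpinv AX XA !mul1mx !trmx1.
Qed.

Lemma eq_connect_root (T : finType) (e e' : rel T) :
  connect e =2 connect e' -> fingraph.root e =1 fingraph.root e'.
Proof. by move=> ee x; rewrite /fingraph.root (eq_pick (ee x)). Qed.

(** Every component of [H] is counted by [cU], and each has exactly one root; this is the exponent
    delivered by [det_forest]. *)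
Lemma cU_roots H : H \in TUn G ->
  cU G H = #|[pred t | t == fingraph.root (adj G H) t]|.
Proof.
move=> HT; have symH := connect_adjC G H.
rewrite /cU (_ : [set _ in _ | _] = comps G H); last first.
  apply/setP=> W; rewrite inE; apply: andb_idr => /imsetP[u _ ->].
  exact: TUn_unicyclic.
rewrite /comps (_ : [set component G H u | u : 'I_n] =
   [set component G H t | t in [pred t | t == fingraph.root (adj G H) t]]).
  apply: card_in_imset => t t'; rewrite !inE => /eqP tr /eqP tr' tt.
  have : t' \in component G H t by rewrite tt mem_component connect0.
  by rewrite mem_component => /(fingraph.rootP symH); rewrite -tr -tr'.
apply/setP=> W; apply/imsetP/imsetP => -[u _ ->]; last by exists u.
exists (fingraph.root (adj G H) u); first by rewrite inE (root_root symH).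
by apply/esym/eq_component; rewrite mem_component connect_root.
Qed.

Lemma det_gram_TUn H : H \in TUn G -> \det (gram A H) = 4%:R ^+ cU G H.
Proof.
move=> HT; have symH := connect_adjC G H.
have cH : #|H| = n by move: HT; rewrite inE => /andP[/eqP].
pose U t := restr G H (component G H t).
pose rt := fingraph.root (adj G H).
have [t|ka kaP] := @fin_all_exists 'I_n _ (fun t k => exists C,
    [/\ cycles G (U t) = [set C], k \in C & ~~ balanced_cycle G C]).
  have /andP[/andP[_ /cards1P[C CE]] nb] := TUn_unicyclic t HT.
  have [C' C'U nbC] := not_balanced nb; have [k kC] := cycle_nonempty C'U.
  move: C'U; rewrite CE inE => /eqP C'C.
  by exists k, C; rewrite -C'C; split=> //; rewrite C'C.
have kaU t : ka t \in U t.
  have [C [CE kC _]] := kaP t.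
  by apply: (subsetP (cycles_sub (_ : C \in cycles G (U t)))); rewrite ?CE ?inE.
have kaH t : ka t \in H by apply: subsetP (restr_sub _ _ _) _ (kaU t).
have sameU t t' k : t = rt t -> t' = rt t' -> k \in U t -> k \in U t' -> t = t'.
  move=> tr tr' kt kt'; have [a [b [_ e]]] := edge_ends G k.
  have ak : a \in edge G k by rewrite e set21.
  have := mem_restr_edge kt ak; have := mem_restr_edge kt' ak.
  rewrite !mem_component => /(fingraph.rootP symH) r' /(fingraph.rootP symH) r.
  by rewrite tr /rt r -r' -/rt -tr'.
(* One cycle edge is removed per component, hence only the values of [ka] at roots are used. The set
   [F] of remaining edges has the same components and provides the parent edges. *)
pose K := [set ka t | t in [pred t | t == rt t]].
pose F := H :\: K.
have conF : connect (adj G F) =2 connect (adj G H).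
  move=> u v; apply/idP/idP; first by apply: connectS; apply: subsetDl.
  move: u v; apply: connect_sub => a b /adjP[k kH e].
  case: (boolP (k \in K)) => [/imsetP[t]|kK]; last by apply: edge_connect e; rewrite inE kK.
  rewrite inE => /eqP tr kE; have [C [CE kC _]] := kaP t.
  have CU : C \in cycles G (U t) by rewrite CE inE.
  rewrite -kE in kC; apply: connectS (cycle_connect CU kC e).
  apply/subsetP=> l; rewrite !inE => /andP[lk lC].
  have lU := subsetP (cycles_sub CU) _ lC.
  rewrite (subsetP (restr_sub _ _ _) _ lU) andbT; apply/imsetP=> -[t'].
  rewrite inE => /eqP tr' lE; case/eqP: lk; rewrite lE kE.
  by congr ka; apply/esym; apply: (sameU _ _ _ tr tr' lU); rewrite lE.
have [d dP] := parent_edges G F.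
have [v|f fP] := @fin_all_exists 'I_n _ (fun v k => if v == rt v then k = ka v else
    k \in F /\ exists2 u, edge G k = [set v; u] & (d u < d v)%N).
  case: eqP => [_|/eqP vr]; first by exists (ka v).
  have [|k [u [kF e du]]] := dP v; first by rewrite (eq_connect_root conF).
  by exists k; split=> //; exists u.
have fH v : f v \in H.
  have := fP v; case: ifP => _ => [->//|[]].
  by rewrite inE => /andP[].
have finj : injective f.
  move=> v v' fv; have := fP v; have := fP v'; rewrite -fv.
  case: ifP => [/eqP v'r ->|v'r [f'F [u' e' du']]]; case: ifP => [/eqP vr|vr].
  - by move=> kE; apply: (sameU _ _ (ka v)) => //; rewrite -kE.
  - by case; rewrite inE => /andP[/negP[]]; apply/imsetP; exists v'; rewrite ?inE -?v'r.
  - move=> fE; move: f'F; rewrite fE inE => /andP[/negP[]].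
    by apply/imsetP; exists v; rewrite ?inE -?vr.
  (* Two vertices sharing a parent edge would each be closer to the root than the other. *)
  case=> _ [u e du]; move: e'; rewrite e => /(set2_eq (edge_neq e))[[-> //]|[v'u u'v]].
  by move: du'; rewrite v'u u'v ltnNge ltnW.
have imH : H = [set f v | v : 'I_n].
  apply/esym/eqP; rewrite eqEcard card_imset // card_ord cH leqnn andbT.
  by apply/subsetP=> _ /imsetP[v _ ->].
rewrite (det_gram A finj imH) cU_roots //.
have [t|y yP] := @fin_all_exists 'I_n _ (fun t (y : 'I_n -> R) =>
    switching G (U t :\ ka t) y /\ forall v, y v ^+ 2 = 1).
  have [C [CE kC _]] := kaP t.
  have [|y sy y2] := @exists_switching _ _ G R (U t :\ ka t); last by exists y.
  apply: acyclic_balanced; apply/setP=> C'; rewrite [RHS]inE; apply/negP=> C'U.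
  have := subsetP (cyclesS G (subD1set (U t) (ka t))) _ C'U; rewrite CE inE => /eqP C'C.
  by have := subsetP (cycles_sub C'U) (ka t); rewrite C'C in_setD1 eqxx => /(_ kC).
have rtf t : t == rt t -> f t = ka t by move=> tr; have := fP t; rewrite tr.
have nrtf v : v != rt v -> f v \in F /\ exists2 u, edge G (f v) = [set v; u] & (d u < d v)%N.
  by move=> vr; have := fP v; rewrite (negPf vr).
(* The row of a root [t] is the sign function of its component cut at [ka t], extended by zero; it
   annihilates every column of [H] except that of [ka t]. *)
apply: (@det_forest _ _ _ (fun t u => if u \in component G H t then y t u else 0) _ d).
- move=> v /nrtf[_ [u e _]]; rewrite mxE expr2 (incidence_sqr hN) //.
  by rewrite e set21.
- move=> u v /nrtf[_ [w e dw]] uv; rewrite mxE => Nu.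
  have : u \in edge G (f v).
    by apply: contraNT Nu => uk; have [z _ _] := hN (f v); rewrite /A z.
  by rewrite e => /set2P[uv'|->//]; rewrite uv' eqxx in uv.
- by move=> t _; rewrite mem_component connect0; case: (yP t).
- move=> t t' /eqP tr /eqP tr' tt; rewrite ifN // mem_component.
  by apply: contra tt => /(fingraph.rootP symH) r; rewrite tr tr' r.
- move=> t v tr vt; have [a [b [_ e]]] := edge_ends G (f v).
  under eq_bigr => u _ do rewrite mxE /A.
  apply/(incidence_annihP hN _ e); rewrite (component_edge _ (fH v) e).
  case: ifP => bW; last by rewrite mulr0.
  apply: (yP t).1 (e); rewrite in_setD1 -(rtf t tr) (inj_eq finj) vt.
  by apply: mem_restr (e) _; rewrite // (component_edge _ (fH v) e).
move=> t tr; have [C [CE kC nbC]] := kaP t; have [sy y2] := yP t.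
have CU : C \in cycles G (U t) by rewrite CE inE.
under eq_bigr => u _ do rewrite mxE /A (rtf t tr).
have [a [b [_ e]]] := edge_ends G (ka t).
have inW w : w \in edge G (ka t) -> w \in component G H t by apply: mem_restr_edge (kaU t).
rewrite (incidence_sumE hN _ e) !inW ?e ?set21 ?set22 //.
have := cycle_switching CU kC e (switchingS (setSD _ (cycles_sub CU)) sy).
rewrite (unbalanced_prod nbC) mulrN1z mulN1r mulNr => ya.
have -> : (sigma G (ka t))%:~R * y t b = - y t a by rewrite ya opprK.
rewrite opprK exprMn expr2 (incidence_sqr hN) ?e ?set21 // mul1r.
have -> : forall z : R, (z + z) ^+ 2 = 4%:R * z ^+ 2 by move=> z; ring.
by rewrite y2 mulr1.
Qed.

Lemma unbalanced_rigid : connected_graph G -> ~~ balanced_graph G ->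
  rigid A [set: 'I_m].
Proof.
move=> /forallP con nb; apply/(rigid_switching hN)=> x sx v.
have [C CS nbC] := not_balanced nb.
have [k [a [b [_ _ xa _]]]] := unbalanced_switching0 CS nbC (switchingS (subsetT _) sx).
apply: (switching_connect0 sx) xa.
by have := con a; rewrite in_setT => /forallP/(_ v); rewrite in_setT.
Qed.

Lemma gramT : gram A [set: 'I_m] = N *m N^T.
Proof.
apply/matrixP=> i j; rewrite !mxE; apply: eq_big => [l|l _]; first by rewrite in_setT.
by rewrite mxE.
Qed.

Lemma laplacian_unit : connected_graph G -> ~~ balanced_graph G ->
  laplacian G R \in unitmx.
Proof.
move=> con nb; rewrite (laplacianE hN) -gramT rigid_gram_unit //.
exact: unbalanced_rigid.
Qed.

Lemma invmx_laplacian_unbalanced i j : connected_graph G -> ~~ balanced_graph G ->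
  invmx (laplacian G R) i j =
     ((\sum_(H in TUn G) 4%:R ^+ cU G H) ^+ 2)^-1 *
     \sum_(k < m)
       (\sum_(H in TUn G | k \in H) 4%:R ^+ cU G H * NH_pinv N H k i) *
       (\sum_(H in TUn G | k \in H) 4%:R ^+ cU G H * NH_pinv N H k j).
Proof.
move=> con nb; have uL := laplacian_unit con nb.
set L := laplacian G R in uL *; have LE : L = N *m N^T := laplacianE hN.
have cT H : H \in TUn G -> #|H| = n by rewrite inE => /andP[/eqP].
have rT H : #|H| = n -> rigid A H -> H \in TUn G by apply: rigid_TUn.
have detE : \det L = \sum_(H in TUn G) 4%:R ^+ cU G H.
  by rewrite LE -gramT (det_gram_expansion cT det_gram_TUn rT).
have adjE k v : (invmx L *m N) v k = (\det L)^-1 *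
    \sum_(H in TUn G | k \in H) 4%:R ^+ cU G H * NH_pinv N H k v.
  under eq_bigr => H /andP[HT kH] do rewrite (NH_pinvE v HT kH).
  rewrite -(adj_gram_expansion (A := A) cT det_gram_TUn rT TUn_dual).
  rewrite gramT -LE /invmx uL mxE big_distrr; apply: eq_bigr => u _.
  by rewrite mxE -mulrA.
(* Inserting [L = N *m N^T] between two copies of the inverse yields the sum over the edges. *)
have -> : invmx L = (invmx L *m N) *m (invmx L *m N)^T.
  rewrite trmx_mul trmx_inv LE trmx_mul trmxK -LE !mulmxA -(mulmxA _ N) -LE.
  by rewrite mulVmx // mul1mx.
rewrite mxE big_distrr; apply: eq_bigr => k _.
rewrite [X in _ * X = _]mxE !adjE -detE /=.
by rewrite mulrACA -invfM -expr2.
Qed.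

End Unbalanced.

(** * The balanced case *)

(** The update scales [s] by [c] and acts as [L] on the complement of [s]. Its inverse commutes with
    [L], with product the orthogonal projection [J] along [s]; the Penrose equations reduce to
    identities for [J]. *)
Lemma mpinv_rank_one_update (R : realFieldType) n (L : 'M[R]_n) (s : 'cV[R]_n) (c : R) :
  c != 0 -> L^T = L -> L *m s = 0 -> s^T *m s = c%:M ->
  L + s *m s^T \in unitmx ->
  mpinv L = invmx (L + s *m s^T) *m L *m invmx (L + s *m s^T).
Proof.
move=> c0 symL Ls ss uM; set M := L + _ in uM *; set P := invmx M.
have symM : M^T = M by rewrite /M linearD /= symL trmx_mul trmxK.
have symP : P^T = P by rewrite /P trmx_inv symM.
have Ms : M *m s = c *: s by rewrite mulmxDl Ls add0r -mulmxA ss mul_mx_scalar.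
have Ps : P *m s = c^-1 *: s.
  have /(congr1 (mulmx P)) := Ms; rewrite mulmxA mulVmx // mul1mx -scalemxAr => e.
  by rewrite [in RHS]e scalerA mulVf // scale1r.
pose J := 1%:M - c^-1 *: (s *m s^T).
have symJ : J^T = J by rewrite /J linearB /= linearZ /= trmx_mul trmxK trmx1.
have PL : P *m L = J.
  have -> : L = M - s *m s^T by rewrite /M addrK.
  by rewrite mulmxBr mulVmx // mulmxA Ps -scalemxAl.
have LP : L *m P = J by rewrite -symJ -PL trmx_mul symL symP.
have sL : s^T *m L = 0 by rewrite -[L in LHS]symL -trmx_mul Ls trmx0.
have JL : J *m L = L by rewrite mulmxBl mul1mx -scalemxAl -mulmxA sL mulmx0 scaler0 subr0.
have JJ : J *m J = J by rewrite -{2}LP mulmxA JL LP.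
have LX : L *m (P *m L *m P) = J by rewrite -(mulmxA P) LP mulmxA LP JJ.
apply: (mpinv_uniq (mpinvP _)); split.
- by rewrite LX.
- by rewrite -[_ *m L *m _]mulmxA LX -(mulmxA P) LP -mulmxA JJ.
- by rewrite LX.
- by rewrite -(mulmxA _ P) PL JJ.
Qed.

Lemma sum_if (R : realFieldType) n (W : {set 'I_n}) (a b : R) :
  \sum_v (if v \in W then a else b) = #|W|%:R * a + #|~: W|%:R * b.
Proof.
rewrite (bigID (mem W)) /= !mulr_natl; congr (_ + _).
  by rewrite (eq_bigr (fun=> a)) ?sumr_const // => v ->.
rewrite (eq_bigr (fun=> b)) => [|v /negPf ->//]; rewrite sumr_const.
by congr (_ *+ _); apply: eq_card => v; rewrite !inE.
Qed.

Section Balanced.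
Variables (R : realFieldType) (n m : nat) (G : signed_graph n m) (N : 'M[R]_(n, m)).
Hypothesis hN : is_incidence G N.
Hypothesis n_gt0 : (0 < n)%N.
Implicit Types (S T : {set 'I_m}) (k l : 'I_m) (H : {set option 'I_m}).
Variable s : 'I_n -> R.
Hypothesis s_switching : switching G [set: 'I_m] s.
Hypothesis s_sqr : forall v, s v ^+ 2 = 1.

(** The incidence matrix bordered by the kernel column [s], which has the index [None]. *)
Let B v (o : option 'I_m) := if o is Some k then N v k else s v.

Definition with_kernel T : {set option 'I_m} := None |: [set Some k | k in T].
Definition edges_of H : {set 'I_m} := [set k | Some k \in H].

Lemma mem_with_kernel T k : (Some k \in with_kernel T) = (k \in T).
Proof. by rewrite !inE /= mem_imset // => ? ? []. Qed.

Lemma with_kernelK : cancel with_kernel edges_of.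
Proof. by move=> T; apply/setP=> k; rewrite inE mem_with_kernel. Qed.

Lemma card_with_kernel T : #|with_kernel T| = #|T|.+1.
Proof.
rewrite cardsU1 card_imset => [|? ? []//].
by rewrite (_ : None \notin _) //; apply/imsetP=> -[].
Qed.

Lemma s_annih l : \sum_v s v * N v l = 0.
Proof.
have [a [b [_ e]]] := edge_ends G l.
by apply/(incidence_annihP hN _ e)/s_switching; rewrite ?in_setT.
Qed.

Lemma s_norm : \sum_v s v * s v = n%:R.
Proof.
rewrite (eq_bigr (fun=> 1)) => [|v _]; first by rewrite sumr_const card_ord.
by rewrite -expr2.
Qed.

Lemma n_neq0 : n%:R != 0 :> R.
Proof. by rewrite pnatr_eq0 -lt0n. Qed.

Lemma annih_with_kernel T (x : 'I_n -> R) :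
  annih B (with_kernel T) x <-> switching G T x /\ \sum_v x v * s v = 0.
Proof.
split=> [ax|[/(annih_switching hN) sx xs] [l|]].
- split; last exact: (ax None (setU11 _ _)).
  apply/(annih_switching hN) => l lT; apply: (ax (Some l)).
  by rewrite mem_with_kernel.
- by rewrite mem_with_kernel; apply: sx.
by [].
Qed.

(** By connectedness [x v * s v] is the same for all [v], and n times this constant is the pairing
    of [x] with [s], which is zero. *)
Lemma connected_rigid S : (forall u v, connect (adj G S) u v) ->
  rigid B (with_kernel S).
Proof.
move=> con x /annih_with_kernel[sx xs] v.
have sS : switching G S s by apply: switchingS (subsetT _) s_switching.
have : n%:R * (x v * s v) = 0.
  rewrite -[RHS]xs (eq_bigr (fun=> x v * s v)).
    by rewrite sumr_const card_ord mulr_natl.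
  by move=> u _; apply: switching_connect sx sS (con _ _).
move/eqP; rewrite !mulf_eq0 (negPf n_neq0) /= => /orP[/eqP//|/eqP sv].
by have := s_sqr v; rewrite sv expr0n => /eqP; rewrite eq_sym oner_eq0.
Qed.

Lemma rigid_spanning_tree H : #|H| = n -> rigid B H ->
  H \in [set with_kernel T | T in spanning_trees G].
Proof.
move=> cH rH; pose v0 := Ordinal n_gt0.
have s0 v : s v != 0.
  by apply/eqP=> sv; have := s_sqr v; rewrite sv expr0n => /eqP; rewrite eq_sym oner_eq0.
(* Without the adjoined column, [s] itself would annihilate all of [H]. *)
have NH : None \in H.
  apply/negPn/negP=> nH; case/eqP: (s0 v0); apply: rH => -[l|] lH.
    exact: s_annih.
  by rewrite lH in nH.
have HE : H = with_kernel (edges_of H).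
  apply/setP=> -[k|]; first by rewrite mem_with_kernel inE.
  by rewrite NH setU11.
move: (edges_of H) HE => T HE; rewrite HE in cH rH *; apply: imset_f.
have con u v : connect (adj G T) u v.
  apply/negPn/negP=> nuv; set W := component G T u.
  (* Rescaling [s] by a constant on [W] and another off [W] keeps the edge conditions of a
     disconnected [T]; these two constants make the result orthogonal to [s]. *)
  pose x w := s w * (if w \in W then #|~: W|%:R else - #|W|%:R).
  have : x u = 0.
    apply: rH; apply/annih_with_kernel; split=> [k a b kT e|].
      rewrite /x (component_edge _ kT e) mulrA; congr (_ * _).
      by apply: s_switching e; rewrite in_setT.
    rewrite (eq_bigr (fun w => if w \in W then #|~: W|%:R else - #|W|%:R)) => [|w _].
      by rewrite sum_if; ring.
    by rewrite /x mulrAC -expr2 s_sqr mul1r.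
  rewrite /x mem_component connect0 => /eqP; rewrite mulf_eq0 (negPf (s0 u)) /=.
  by rewrite pnatr_eq0 cards_eq0 => /eqP/setP/(_ v); rewrite !inE nuv.
rewrite inE; apply/andP; split.
  by apply/forallP=> u; rewrite in_setT; apply/forallP=> v; rewrite in_setT con.
apply/eqP/setP=> C; rewrite [RHS]inE; apply/negP=> CT.
have [k kC] := cycle_nonempty CT; have kT := subsetP (cycles_sub CT) _ kC.
have [a [b [_ e]]] := edge_ends G k.
(* Dropping an edge of a cycle preserves connectedness, hence rigidity, but leaves only n - 1
   columns. *)
have /connected_rigid/rigid_card : forall u v, connect (adj G (T :\ k)) u v.
  move=> u v; apply: (connectD1 e) (con u v).
  exact: connectS (setSD _ (cycles_sub CT)) _ _ (cycle_connect CT kC e).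
by rewrite -cH !card_with_kernel (cardsD1 k T) kT ltnn.
Qed.

(** The dual row of a tree edge is a multiple of [s] on each side of it. Orthogonality to [s] forces
    the constants to be proportional to the sizes of the opposite sides with opposite signs, and 1/n
    normalizes because the sizes add up to n. The factor [- sigma] arises since the path sign refers
    to the head on the head side. *)
Definition tree_row T k v : R :=
  n%:R^-1 * edge_w G N k * (sgn_edge_path G T k v)%:~R *
  (if v \in tail_comp G N T k then #|head_comp G N T k|%:R
   else - (sigma G k)%:~R * #|tail_comp G N T k|%:R).

Lemma spanning_tree_connect T u v : T \in spanning_trees G -> connect (adj G T) u v.
Proof.
rewrite inE => /andP[/forallP con _].
by have := con u; rewrite in_setT => /forallP/(_ v); rewrite in_setT.
Qed.

Lemma head_compE T k v : T \in spanning_trees G -> k \in T ->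
  (v \in head_comp G N T k) = (v \notin tail_comp G N T k).
Proof.
move=> TT kT; have [t [h [e tE hE _]]] := tail_head hN k.
rewrite /head_comp /tail_comp (big_pred1 h) // (big_pred1 t) // !mem_component.
have nth : ~~ connect (adj G (T :\ k)) t h.
  apply/negP=> /(mem_cycle kT e)[C]; move: TT; rewrite inE => /andP[_ /eqP ->].
  by rewrite inE.
apply/idP/idP => [hv|tv].
  by apply: contra nth => tv; apply: connect_trans tv _; rewrite connect_adjC.
case: (connect_split e (spanning_tree_connect v t TT)); rewrite connect_adjC //.
by move=> h'; rewrite h' in tv.
Qed.

Lemma tree_rowE T k t v : T \in spanning_trees G -> k \in T -> is_tail G N k t ->
  tree_row T k v = n%:R^-1 * N t k * s t * s v *
    (if v \in tail_comp G N T k then #|head_comp G N T k|%:R else - #|tail_comp G N T k|%:R).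
Proof.
move=> TT kT tt; have hcE := head_compE v TT kT.
have [t' [h [e tE hE wE]]] := tail_head hN k.
have := tE t; rewrite tt => /esym/eqP t't; rewrite -{t'}t't in e tE wE.
have sS q : q \in edge G k -> connect (adj G (T :\ k)) v q ->
    ~~ connect (adj G (T :\ k)) t h ->
    (sgn_edge_path G T k v)%:~R = s v * s q.
  move=> qk vq nth; apply: sgn_pathE => //.
  - by move=> l a b _ el _; apply: s_switching el; rewrite in_setT.
  - move=> q' q'k vq'; have qq' : connect (adj G (T :\ k)) q q'.
      by apply: connect_trans vq'; rewrite connect_adjC.
    move: qk q'k qq'; rewrite e => /set2P[]-> /set2P[]-> // => [|h']; first by move/negP: nth.
    by case/negP: nth; rewrite connect_adjC.
have nth : ~~ connect (adj G (T :\ k)) t h.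
  apply/negP=> /(mem_cycle kT e)[C]; move: TT; rewrite inE => /andP[_ /eqP ->].
  by rewrite inE.
have tailC : (v \in tail_comp G N T k) = connect (adj G (T :\ k)) t v.
  by rewrite /tail_comp (big_pred1 t) // mem_component.
have headC : (v \in head_comp G N T k) = connect (adj G (T :\ k)) h v.
  by rewrite /head_comp (big_pred1 h) // mem_component.
rewrite /tree_row wE; case: (boolP (v \in tail_comp G N T k)) => [tv|ntv].
  rewrite (sS t) ?e ?set21 //; last by rewrite connect_adjC -tailC.
  by ring.
rewrite (sS h) ?e ?set22 //; last by rewrite connect_adjC -headC hcE.
by rewrite (s_switching (in_setT k) e); ring.
Qed.

Lemma card_head_tail T k : T \in spanning_trees G -> k \in T ->
  #|head_comp G N T k|%:R + #|tail_comp G N T k|%:R = n%:R :> R.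
Proof.
move=> TT kT; have -> : head_comp G N T k = ~: tail_comp G N T k.
  by apply/setP=> v; rewrite head_compE // inE.
by rewrite -natrD addnC cardsC card_ord.
Qed.

Definition kernel_row H (o : option 'I_m) v : R :=
  if o is Some k then tree_row (edges_of H) k v else n%:R^-1 * s v.

Lemma tree_dual_rows T : T \in spanning_trees G ->
  dual_rows B (with_kernel T) (kernel_row (with_kernel T)).
Proof.
move=> TT [k|] [l|]; rewrite ?mem_with_kernel /kernel_row ?with_kernelK /B => kT lT.
- have [t [h [e tE hE wE]]] := tail_head hN k.
  have tt : is_tail G N k t by rewrite tE.
  under eq_bigr => v _ do rewrite (tree_rowE v TT kT tt).
  have tailC v : (v \in tail_comp G N T k) = (v \in component G (T :\ k) t).
    by rewrite /tail_comp (big_pred1 t).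
  rewrite (inj_eq (@Some_inj _)).
  case: (eqVneq k l) => [<-|kl]; last first.
    have [a [b [_ el]]] := edge_ends G l; apply/(incidence_annihP hN _ el).
    have lTk : l \in T :\ k by rewrite !inE eq_sym kl.
    rewrite !tailC (component_edge _ lTk el) (s_switching (in_setT l) el).
    by case: ifP => _; ring.
  rewrite (incidence_sum hN _ e).
  have -> : t \in tail_comp G N T k by rewrite tailC mem_component connect0.
  have -> : (h \in tail_comp G N T k) = false.
    apply: negbTE; rewrite -head_compE // /head_comp (big_pred1 h) //.
    by rewrite mem_component connect0.
  have NN : N t k * N t k = 1 by apply: (incidence_sqr hN); rewrite e set21.
  have sh : s h = (sigma G k)%:~R * s t.
    by apply: s_switching; rewrite ?in_setT // setUC.
  rewrite (incidence_other hN e) sh -(card_head_tail TT kT).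
  have nn := n_neq0; rewrite -(card_head_tail TT kT) in nn.
  set p := #|head_comp _ _ _ _|%:R in nn *; set q := #|tail_comp _ _ _ _|%:R in nn *.
  transitivity ((p + q)^-1 * (N t k * N t k) * (s t ^+ 2) *
     (p + q * ((sigma G k)%:~R * (sigma G k)%:~R))); first by ring.
  by rewrite NN s_sqr sigma_sqr !mulr1 mulVf.
- have [t [h [e tE hE wE]]] := tail_head hN k.
  have tt : is_tail G N k t by rewrite tE.
  under eq_bigr => v _ do rewrite (tree_rowE v TT kT tt) mulrAC.
  under eq_bigr => v _ do rewrite -[_ * s v * s v]mulrA -expr2 s_sqr mulr1.
  rewrite -mulr_sumr sum_if (_ : ~: tail_comp G N T k = head_comp G N T k).
    by rewrite /=; ring.
  by apply/setP=> v; rewrite head_compE // inE.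
- under eq_bigr => v _ do rewrite -mulrA.
  by rewrite -mulr_sumr s_annih mulr0.
under eq_bigr => v _ do rewrite -mulrA.
by rewrite -mulr_sumr s_norm mulVf ?n_neq0.
Qed.

(** Duality bounds the number of columns from above and rigidity from below. *)
Lemma card_tree T : T \in spanning_trees G -> #|with_kernel T| = n.
Proof.
move=> TT; apply/eqP; rewrite eqn_leq (dual_rows_card (tree_dual_rows TT)).
by apply: rigid_card; apply: connected_rigid => u v; apply: spanning_tree_connect.
Qed.

Lemma det_gram_tree T : T \in spanning_trees G ->
  \det (gram B (with_kernel T)) = n%:R ^+ 2.
Proof.
move=> TT; have con u v := spanning_tree_connect u v TT.
pose rt := fingraph.root (adj G T).
have rtE u v : rt u = rt v by apply/(fingraph.rootP (connect_adjC G T)).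
have [d dP] := parent_edges G T.
have [v|f fP] := @fin_all_exists 'I_n _ (fun v o => if v == rt v then o = None else
    exists k u, [/\ o = Some k, k \in T, edge G k = [set v; u] & (d u < d v)%N]).
  case: eqP => [_|/eqP vr]; first by exists None.
  have [k [u [kT e du]]] := dP v vr.
  by exists (Some k), k, u.
have rtf v : v == rt v -> f v = None by move=> vr; have := fP v; rewrite vr.
have nrtf v : v != rt v ->
    exists k u, [/\ f v = Some k, k \in T, edge G k = [set v; u] & (d u < d v)%N].
  by move=> vr; have := fP v; rewrite (negPf vr).
have finj : injective f.
  move=> v v' fv.
  case: (boolP (v == rt v)) => vr; case: (boolP (v' == rt v')) => v'r.
  - by rewrite (eqP vr) (eqP v'r).
  - by have [k [u [fk _ _ _]]] := nrtf _ v'r; move: fv; rewrite fk rtf.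
  - by have [k [u [fk _ _ _]]] := nrtf _ vr; move: fv; rewrite fk rtf.
  have [k [u [fk _ e du]]] := nrtf _ vr; have [k' [u' [fk' _ e' du']]] := nrtf _ v'r.
  move: fv; rewrite fk fk' => -[kk]; rewrite -kk in e'.
  move: e'; rewrite e => /(set2_eq (edge_neq e))[[-> //]|[v'u u'v]].
  by move: du'; rewrite v'u u'v ltnNge ltnW.
have imT : with_kernel T = [set f v | v : 'I_n].
  apply/esym/eqP; rewrite eqEcard card_imset // card_ord card_tree // leqnn andbT.
  apply/subsetP=> _ /imsetP[v _ ->]; case: (boolP (v == rt v)) => vr.
    by rewrite rtf // setU11.
  by have [k [u [-> kT _ _]]] := nrtf _ vr; rewrite mem_with_kernel.
rewrite (det_gram B finj imT).
have c1 : #|[pred t | t == rt t]| = 1%N.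
  apply: (@eq_card1 _ (rt (Ordinal n_gt0))) => t; rewrite !inE.
  by rewrite (rtE t (Ordinal n_gt0)).
(* A tree has one root. Its column is the adjoined [s], and the row substituted for it is [s] as
   well, so the pairing is n. *)
transitivity ((n%:R ^+ 2) ^+ #|[pred t | t == rt t]| : R); last by rewrite c1 expr1.
apply: (@det_forest _ _ _ (fun=> s) _ d).
- move=> v /nrtf[k [u [fk _ e _]]]; rewrite mxE fk expr2 (incidence_sqr hN) //.
  by rewrite e set21.
- move=> u v /nrtf[k [w [fk _ e dw]]] uv; rewrite mxE fk => Nu.
  have : u \in edge G k.
    by apply: contraNT Nu => uk; have [z _ _] := hN k; rewrite /B z.
  by rewrite e => /set2P[uv'|->//]; rewrite uv' eqxx in uv.
- by move=> t _; apply: s_sqr.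
- by move=> t t' /eqP -> /eqP ->; rewrite (rtE t t') eqxx.
- move=> t v /eqP tr vt; have vr : v != rt v.
    by apply: contra vt => /eqP ->; rewrite [t]tr (rtE v t).
  have [k [u [fk _ _ _]]] := nrtf _ vr.
  under eq_bigr => w _ do rewrite mxE fk /B.
  exact: s_annih.
move=> t tr; under eq_bigr => u _ do rewrite mxE (rtf t tr) /B.
by rewrite s_norm.
Qed.

Lemma gram_kernel : gram B [set: option 'I_m] =
  N *m N^T + (\col_v s v) *m (\col_v s v)^T.
Proof.
apply/matrixP=> i j; rewrite !mxE (bigD1 None) ?in_setT //= addrC; congr (_ + _).
  rewrite (reindex_omap Some id) => [|[k|]]; rewrite ?andbF //.
  by apply: eq_big => [k|k _]; rewrite ?in_setT ?eqxx ?mxE.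
by rewrite big_ord1 !mxE.
Qed.

Lemma mpinv_laplacian_tree_rows i j : connected_graph G ->
  mpinv (laplacian G R) i j = \sum_(k < m)
    ((tau G)%:R^-1 * \sum_(T in spanning_trees G | k \in T) tree_row T k i) *
    ((tau G)%:R^-1 * \sum_(T in spanning_trees G | k \in T) tree_row T k j).
Proof.
move=> con; set L := laplacian G R; have LE : L = N *m N^T := laplacianE hN.
pose sv := \col_v s v; pose M := L + sv *m sv^T.
have ME : M = gram B [set: option 'I_m] by rewrite gram_kernel -LE.
have TE : [set: option 'I_m] = with_kernel [set: 'I_m].
  by apply/setP=> -[k|]; rewrite in_setT ?mem_with_kernel ?in_setT ?setU11.
have uM : M \in unitmx.
  rewrite ME TE rigid_gram_unit //; apply: connected_rigid => u v.
  by have /forallP/(_ u) := con; rewrite in_setT => /forallP/(_ v); rewrite in_setT.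
pose HH := [set with_kernel T | T in spanning_trees G].
have cH H : H \in HH -> #|H| = n by case/imsetP=> T TT ->; apply: card_tree.
have dH H : H \in HH -> \det (gram B H) = n%:R ^+ 2.
  by case/imsetP=> T TT ->; apply: det_gram_tree.
have rH H : #|H| = n -> rigid B H -> H \in HH by apply: rigid_spanning_tree.
have XH H : H \in HH -> dual_rows B H (kernel_row H).
  by case/imsetP=> T TT ->; apply: tree_dual_rows.
have wkinj : injective with_kernel := can_inj with_kernelK.
have detM : \det M = (tau G)%:R * n%:R ^+ 2.
  rewrite ME (det_gram_expansion cH dH rH) sumr_const card_imset //.
  by rewrite mulr_natl.
have adjE k v : (invmx M *m N) v k =
    (tau G)%:R^-1 * \sum_(T in spanning_trees G | k \in T) tree_row T k v.
  transitivity ((\det M)^-1 *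
      \sum_(H in HH | Some k \in H) n%:R ^+ 2 * kernel_row H (Some k) v).
    rewrite -(adj_gram_expansion (A := B) cH dH rH XH) -ME /invmx uM mxE big_distrr.
    by apply: eq_bigr => u _; rewrite mxE -mulrA.
  (* All trees carry the same weight n^2, which cancels against the determinant and leaves a plain
     average. *)
  rewrite -mulr_sumr mulrA detM invfM divfK ?expf_neq0 ?n_neq0 //.
  congr (_ * _); rewrite big_mkcondr big_imset /=; last by move=> ? ? _ _ /wkinj.
  rewrite -big_mkcondr; apply: eq_big => [T|T _]; first by rewrite mem_with_kernel.
  by rewrite with_kernelK.
have symL : L^T = L by rewrite LE trmx_mul trmxK.
have Ls : L *m sv = 0.
  rewrite LE -mulmxA (_ : N^T *m sv = 0) ?mulmx0 //; apply/colP=> l.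
  by rewrite !mxE -[RHS](s_annih l); apply: eq_bigr => v _; rewrite !mxE mulrC.
have ss : sv^T *m sv = n%:R%:M.
  apply/matrixP=> a b; rewrite !ord1 !mxE mulr1n -s_norm.
  by apply: eq_bigr => v _; rewrite !mxE.
rewrite (mpinv_rank_one_update n_neq0 symL Ls ss uM) -/M.
have -> : invmx M *m L *m invmx M = (invmx M *m N) *m (invmx M *m N)^T.
  have symM : M^T = M by rewrite /M raddfD /= symL trmx_mul trmxK.
  by rewrite trmx_mul trmx_inv symM [X in _ *m X *m _]LE !mulmxA.
rewrite mxE; apply: eq_bigr => k _.
by rewrite [X in _ * X = _]mxE !adjE.
Qed.

(** The two normalizations 1/n absorb n^2, the edge weights square to 1, and the four cases of [Psi]
    are the products of the two cases of [tree_row]. *)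
Lemma Psi_tree_rows Tr Ts k i j : Tr \in spanning_trees G -> Ts \in spanning_trees G ->
  k \in Tr -> k \in Ts ->
  (sgn_edge_path G Tr k i)%:~R * (sgn_edge_path G Ts k j)%:~R * Psi G N Tr Ts k i j =
  n%:R ^+ 2 * (tree_row Tr k i * tree_row Ts k j).
Proof.
move=> Trt Tst kr ks; have [t [h [e _ _ wE]]] := tail_head hN k.
have w2 : edge_w G N k ^+ 2 = 1 by rewrite wE expr2 (incidence_sqr hN) // e set21.
rewrite /Psi /tree_row !head_compE //.
set a := (sgn_edge_path _ _ _ i)%:~R; set b := (sgn_edge_path _ _ _ j)%:~R.
set z := (X in _ = _ * (_ * _ * _ * X * _)); set z' := (X in _ = _ * (_ * (_ * _ * _ * X))).
have -> : n%:R ^+ 2 * (n%:R^-1 * edge_w G N k * a * z * (n%:R^-1 * edge_w G N k * b * z')) =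
   (n%:R * n%:R^-1) ^+ 2 * edge_w G N k ^+ 2 * (a * b * (z * z')) by ring.
rewrite w2 mulfV ?n_neq0 // expr1n !mul1r; congr (_ * _); rewrite /z /z'.
have := sigma_sqr R G k.
case: (i \in _); case: (j \in _) => /= ss; try by ring.
(* Both vertices on the head side: the two factors [- sigma] cancel. *)
rewrite mulrACA mulrNN ss; ring.
Qed.

End Balanced.

Theorem theorem5p1 (R : realFieldType) (n m : nat) (G : signed_graph n m)
    (N : 'M[R]_(n, m)) (hn : (2 <= n)%N) (hconn : connected_graph G)
    (hN : is_incidence G N) :
  (balanced_graph G ->
   forall i j : 'I_n,
     mpinv (laplacian G R) i j =
     (n%:R ^+ 2 * (tau G)%:R ^+ 2)^-1 *
     \sum_(k < m)
       \sum_(Tr in spanning_trees G | k \in Tr)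
         \sum_(Ts in spanning_trees G | k \in Ts)
           (sgn_edge_path G Tr k i)%:~R * (sgn_edge_path G Ts k j)%:~R *
           Psi G N Tr Ts k i j)
  /\
  (~~ balanced_graph G ->
   [/\ laplacian G R \in unitmx,
       forall i j : 'I_n,
         invmx (laplacian G R) i j =
         ((\sum_(H in TUn G) 4%:R ^+ cU G H) ^+ 2)^-1 *
         \sum_(k < m)
           (\sum_(H in TUn G | k \in H) 4%:R ^+ cU G H * NH_pinv N H k i) *
           (\sum_(H in TUn G | k \in H) 4%:R ^+ cU G H * NH_pinv N H k j)
     & forall (H : {set 'I_m}) (k : 'I_m) (v : 'I_n),
         H \in TUn G -> k \in H -> NH_pinv N H k v = NH_formula G N H k v]).
Proof.
have n_gt0 : (0 < n)%N by apply: leq_trans hn.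
split=> [bal i j|nb].
  have [s sS s2] := exists_switching R bal.
  rewrite (mpinv_laplacian_tree_rows hN n_gt0 sS s2) // big_distrr.
  apply: eq_bigr => k _ /=.
  have -> : forall t x y : R, t^-1 * x * (t^-1 * y) = (t ^+ 2)^-1 * (x * y).
    by move=> t x y; rewrite mulrACA -invfM -expr2.
  rewrite big_distrlr mulr_sumr [RHS]mulr_sumr.
  apply: eq_bigr => Tr /andP[Trt kr] /=; rewrite mulr_sumr [RHS]mulr_sumr.
  apply: eq_bigr => Ts /andP[Tst ks].
  rewrite (Psi_tree_rows hN n_gt0) // [RHS]mulrA; congr (_ * _).
  by rewrite [X in _ = X * _]invfM [RHS]mulrAC mulVf ?mul1r // expf_neq0 // n_neq0.
split; first exact: laplacian_unit hN hconn nb.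
  by move=> i j; apply: invmx_laplacian_unbalanced.
by move=> H k v; apply: NH_pinvE.
Qed.
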